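(* Let $p$ and $q$ be primes. Suppose that $(X,S)$ is an association scheme which satisfies the following: (i) $T :=\mathbf{O}^\theta(S)$ is the elementary abelian group of order $p^2$; (ii) $S/\!/T$ is the cyclic group of order $q$. Then $\{ \chi(\sigma_{1_X}) \mid \chi \in \mathrm{Irr}(S),\ \chi(\sigma_{1_X})\neq 1 \} = \{ |l| \mid l \in \mathcal{L} \}$, where $\mathcal{L}$ is the set of lines on $X/T$ associated with $(X,S)$.
   Context: An association scheme $(X,S)$ consists of a non-empty finite set $X$ and a partition $S$ of $X\times X$ such that: (i) $1_X:=\{(x,x)\mid x\in X\}\in S$; (ii) for each $s\in S$, $s^*:=\{(x,y)\mid (y,x)\in s\}\in S$; (iii) for all $s,t,u\in S$ the number $c_{st}^u:=|xs\cap yt^*|$ is constant whenever $(x,y)\in u$, where $xs:=\{y\in X\mid (x,y)\in s\}$. The valency of $s$ is $n_s:=c_{ss^*}^{1_X}$. For non-empty $P,Q\subseteq S$, the complex product $PQ$ is the set of all $s\in S$ with $c_{pq}^s\neq 0$ for some $p\in P$, $q\in Q$; singletons $\{s\}$ are written $s$. A non-empty $T\subseteq S$ is closed if $TT\subseteq T$, thin if moreover all its elements have valency 1 (then $T$ is a group under the relational product), and strongly normal if it is closed and $s^*Ts\subseteq T$ for all $s\in S$. The thin residue $\mathbf{O}^\theta(S)$ is the intersection of all strongly normal closed subsets of $S$ (it is itself strongly normal). Saying that $\mathbf{O}^\theta(S)$ is a group means that it is thin. For $T$ closed, $xT:=\bigcup_{t\in T}xt$, $X/T:=\{xT\mid x\in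 X\}$ is the set of cosets, $s^T:=\{(xT,yT)\mid y\in xTsT\}$ and $S/\!/T:=\{s^T\mid s\in S\}$; $(X/T,S/\!/T)$ is the quotient scheme, and it is thin (a group) exactly when $T$ is strongly normal. Characters. For $s\in S$, $\sigma_s$ is the adjacency matrix of $s$ (the $0/1$ matrix indexed by $X$ with $(\sigma_s)_{xy}=1$ iff $(x,y)\in s$). The adjacency algebra $\mathbb{C}S=\bigoplus_{s\in S}\mathbb{C}\sigma_s$ is a semisimple subalgebra of $\mathrm{Mat}_{|X|}(\mathbb{C})$, and $\mathrm{Irr}(S)$ is the set of its irreducible characters; $\sigma_{1_X}$ is the identity matrix, so $\chi(\sigma_{1_X})$ is the degree of $\chi$. Lines. Let $X_1,\dots,X_m$ be the cosets of $T$ in $X$. For $s\in S$ put $L(s):=\{t\in T\mid ts=s\}$; it satisfies $L(s)=L(s')$ for $s'\in TsT$. For $i,j\in\{1,\dots,m\}$ put $L_{ij}:=L(s)$ for any $s\in S$ with $s\cap(X_i\times X_j)\neq\varnothing$ (independent of the choice of $s$). For a subgroup $M$ with $\{1_X\}<M<T$ (strict inclusions) put $L_i(M):=\{i\}\cup\{j\mid L_{ij}=M\}$. With point set $\mathcal{P}:=\{1,\dots,m\}$ (identified with $X/T$), the set of lines is $\mathcal{L}:=\{L_i(M)\mid \{1_X\}<M<T,\ |L_i(M)|\neq 1,\ 1\le i\le m\}$. *)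

(* Defs.v *)
From HB Require Import structures.
From mathcomp Require Import all_boot all_order all_algebra all_fingroup all_solvable.
From mathcomp Require Import reals complex.

Set Implicit Arguments.
Unset Strict Implicit.
Unset Printing Implicit Defensive.

Import GRing.Theory.
Local Open Scope ring_scope.

Section Schemes.

Variable X : finType.
Implicit Types (r s t u : {set X * X}) (x y : X).
Implicit Types (S T P Q M : {set {set X * X}}).

Definition rel_id : {set X * X} := [set z | z.1 == z.2].

Definition rel_inv s : {set X * X} := [set z | (z.2, z.1) \in s].

Definition rel_mul s t : {set X * X} :=
  [set z | [exists y, ((z.1, y) \in s) && ((y, z.2) \in t)]].

(* the set [xs] *)
Definition nbr x s : {set X} := [set y | (x, y) \in s].

Definition inter_count s t x y : nat := #|nbr x s :&: nbr y (rel_inv t)|.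

Definition association_scheme S : Prop :=
  [/\ (0 < #|X|)%N,
      partition S [set: X * X],
      rel_id \in S,
      {in S, forall s, rel_inv s \in S}
    & {in S & S & S, forall s t u, exists c : nat,
        forall x y, (x, y) \in u -> inter_count s t x y = c}].

(* c_{st}^u, read off at an arbitrary pair of u (and 0 if u is empty) *)
Definition int_num s t u : nat :=
  if [pick z | z \in u] is Some z then inter_count s t z.1 z.2 else 0%N.

Definition valency s : nat := int_num s (rel_inv s) rel_id.

Definition cprod S P Q : {set {set X * X}} :=
  [set s in S | [exists p in P, exists q in Q, int_num p q s != 0%N]].

Definition closed_subset S T : bool :=
  [&& T != set0, T \subset S & cprod S T T \subset T].

Definition thin S T : bool :=
  closed_subset S T && [forall t in T, valency t == 1%N].

Definition strongly_normal S T : bool :=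
  closed_subset S T &&
  [forall s in S, cprod S (cprod S [set rel_inv s] T) [set s] \subset T].

Definition thin_residue S : {set {set X * X}} :=
  \bigcap_(T : {set {set X * X}} | strongly_normal S T) T.

(* T is thin and, under the relational product, isomorphic to the group G *)
Definition thin_isog S T (gT : finGroupType) (G : {group gT}) : Prop :=
  thin S T /\
  exists f : gT -> {set X * X},
    [/\ {in G &, injective f}, f @: G = T
      & {in G &, forall a b, f (a * b)%g = rel_mul (f a) (f b)}].

Definition rel_subgroup M T : bool :=
  [&& M \subset T, rel_id \in M,
      [forall s in M, rel_inv s \in M]
    & [forall s in M, forall t in M, rel_mul s t \in M]].

(* the set [xT] *)
Definition coset_at T x : {set X} := \bigcup_(t in T) nbr x t.

Definition cosets T : {set {set X}} := [set coset_at T x | x : X].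

(* X/T, as a type *)
Definition quo T : finType := {A : {set X} | A \in cosets T}.

(* s^T; [coset_at] applied to the complex product TsT gives xTsT *)
Definition quo_rel S T s : {set quo T * quo T} :=
  [set z : quo T * quo T | [exists x, exists y,
    [&& sval z.1 == coset_at T x, sval z.2 == coset_at T y
      & y \in coset_at (cprod S (cprod S T [set s]) T) x]]].

Definition quo_rels S T : {set {set quo T * quo T}} :=
  [set quo_rel S T s | s in S].

Definition lstab S T s : {set {set X * X}} :=
  [set t in T | cprod S [set t] [set s] == [set s]].

Definition lstab_pts S T (i j : quo T) : {set {set X * X}} :=
  if [pick s in S | s :&: setX (sval i) (sval j) != set0] is Some s
  then lstab S T s else set0.

Definition line S T M (i : quo T) : {set quo T} :=
  i |: [set j | lstab_pts S i j == M].

Definition lines S T : {set {set quo T}} :=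
  [set l | [exists M : {set {set X * X}}, exists i : quo T,
    [&& rel_subgroup M T, [set rel_id] \proper M, M \proper T,
        #|line S M i| != 1%N & l == line S M i]]].

End Schemes.

Section Characters.

Variables (C : fieldType) (X : finType) (S : {set {set X * X}}).

Definition adj_mx (s : {set X * X}) : 'M[C]_#|X| :=
  \matrix_(i, j) ((enum_val i, enum_val j) \in s)%:R.

Definition adj_space : {vspace 'M[C]_#|X|} :=
  <<[seq adj_mx s | s in S]>>%VS.

Definition adj_alg := subvs_of adj_space.

(* For s in S the projection [vsproj] does nothing but retype the matrix. *)
Definition sigma (s : {set X * X}) : adj_alg := vsproj adj_space (adj_mx s).

(* For an association scheme, the span is closed under matrix multiplication,
   so that [vsproj] again only retypes. *)
Definition adj_mul (a b : adj_alg) : adj_alg :=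
  vsproj adj_space (vsval a *m vsval b).

Definition adj_repr d (rho : {linear adj_alg -> 'M[C]_d}) : Prop :=
  rho (sigma (rel_id X)) = 1%:M /\
  forall a b, rho (adj_mul a b) = rho a *m rho b.

(* As in mxrepresentation, subspaces are row spaces and matrices act on the
   right. *)
Definition adj_irr d (rho : {linear adj_alg -> 'M[C]_d}) : Prop :=
  (0 < d)%N /\
  forall U : 'M[C]_d,
    (forall a, stablemx U (rho a)) -> U != 0 -> row_full U.

Definition Irr (chi : adj_alg -> C) : Prop :=
  exists d (rho : {linear adj_alg -> 'M[C]_d}),
    [/\ adj_repr rho, adj_irr rho & forall a, chi a = \tr (rho a)].

End Characters.

(* Main.v *)
(** The grading of S by the group S//T, cyclic of prime order, makes CS a sum of
    pieces indexed by the degrees; a relation s of degree g spans, up to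
    multiplication by T, the piece of degree g, and it moves the T-characters
    trivial on L(s) bijectively to those trivial on L(s^* ).  Hence, if v generates
    an irreducible module and T acts on v by a character lambda, the nonzero
    vectors v s (one s for each degree) span the module.  If lambda is trivial,
    the module has dimension 1, the degrees forming a cyclic group.  If lambda is
    not trivial, these vectors carry pairwise distinct T-characters: otherwise
    some, hence every, degree fixes lambda, and ker lambda is a strongly normal
    closed subset smaller than T.  So the dimension counts the degrees with
    L <= ker lambda.  As |T| = p^2 and L is nontrivial outside degree 1 (else S
    would be thin), these are the degree 1 and those with L = ker lambda: the
    dimension is the size of the line of ker lambda.  Conversely every M with
    1 < M < T is the kernel of a character of T occurring in the standard module C^X, and
    the submodule generated by a corresponding eigenvector is irreducible. *)
Require Import Defs.
From HB Require Import structures.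
From mathcomp Require Import all_boot all_order all_algebra all_fingroup all_solvable.
From mathcomp Require Import reals complex spectral.

Set Implicit Arguments.
Unset Strict Implicit.
Unset Printing Implicit Defensive.

Import GRing.Theory Num.Theory.
Local Open Scope ring_scope.
(* gproduct has a cprod of its own, the central product. *)
Local Notation cprod := Defs.cprod.

(** * Association schemes and thin closed subsets *)

Section Scheme.

Variables (X : finType) (S : {set {set X * X}}).
Hypothesis hS : association_scheme S.

(** Relations are named by representative pairs throughout, which turns statements about structure
    constants into statements about points. *)
Definition rel_at x y : {set X * X} := pblock S (x, y).

Lemma rel_at_in x y : rel_at x y \in S.
Proof. by case: hS => _ /and3P[/eqP cS _ _] _ _ _; rewrite pblock_mem // cS inE. Qed.

Lemma mem_rel_at s x y : s \in S -> ((x, y) \in s) = (rel_at x y == s).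
Proof.
case: hS => _ /and3P[/eqP cS tS _] _ _ _ sS; apply/idP/eqP => [xy | <-].
  exact: def_pblock.
by rewrite mem_pblock cS inE.
Qed.

Lemma rel_atP s : s \in S -> exists x y, s = rel_at x y.
Proof.
move=> sS; case: (hS) => _ /and3P[_ _ S0] _ _ _.
have /set0Pn[[x y] xy] : s != set0 by apply: contraNneq S0 => <-.
by exists x, y; apply/esym/eqP; rewrite -mem_rel_at.
Qed.

Lemma rel_at_id x y : (rel_at x y == rel_id X) = (x == y).
Proof. by case: hS => _ _ idS _ _; rewrite -mem_rel_at // inE. Qed.

Lemma rel_inv_at x y : rel_inv (rel_at x y) = rel_at y x.
Proof.
case: hS => _ _ _ invS _; apply/esym/eqP.
by rewrite -mem_rel_at ?invS ?rel_at_in // inE mem_rel_at ?rel_at_in.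
Qed.

Lemma rel_at_sym x y x' y' :
  rel_at x y = rel_at x' y' -> rel_at y x = rel_at y' x'.
Proof. by move=> e; rewrite -rel_inv_at e rel_inv_at. Qed.

Lemma inter_countE s u x y : s \in S -> u \in S ->
  inter_count s u x y = #|[set z | (rel_at x z == s) && (rel_at z y == u)]|.
Proof.
by move=> sS uS; apply: eq_card => z; rewrite !inE /= -!mem_rel_at.
Qed.

Lemma inter_count_rel s u x y x' y' : s \in S -> u \in S ->
  rel_at x y = rel_at x' y' -> inter_count s u x y = inter_count s u x' y'.
Proof.
move=> sS uS exy; case: (hS) => _ _ _ _ /(_ s u _ sS uS (rel_at_in x y))[c cP].
by rewrite !cP ?mem_rel_at ?rel_at_in ?exy.
Qed.

Lemma int_numE s u x y : s \in S -> u \in S ->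
  int_num s u (rel_at x y) =
  #|[set z | (rel_at x z == s) && (rel_at z y == u)]|.
Proof.
move=> sS uS; rewrite -inter_countE // /int_num; case: pickP => [[a b]|/(_ (x, y))].
  by rewrite mem_rel_at ?rel_at_in // => /eqP /= e; apply: inter_count_rel.
by rewrite mem_rel_at ?rel_at_in ?eqxx.
Qed.

Lemma int_num_neq0 s u x y : s \in S -> u \in S ->
  (int_num s u (rel_at x y) != 0%N) =
  [exists z, (rel_at x z == s) && (rel_at z y == u)].
Proof.
move=> sS uS; rewrite int_numE // cards_eq0.
apply/set0Pn/existsP => [[z zP] | [z zP]]; exists z; move: zP; by rewrite inE.
Qed.

Lemma cprod_rel (P Q : {set {set X * X}}) x y : P \subset S -> Q \subset S ->
  reflect (exists2 z, rel_at x z \in P & rel_at z y \in Q)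
          (rel_at x y \in cprod S P Q).
Proof.
move=> /subsetP PS /subsetP QS; rewrite inE rel_at_in /=.
apply: (iffP existsP) => [[s /andP[sP /existsP[u /andP[uQ]]]] | [z zP zQ]].
  rewrite int_num_neq0 ?(PS s) ?(QS u) // => /existsP[z /andP[/eqP es /eqP eu]].
  by exists z; rewrite ?es ?eu.
exists (rel_at x z); rewrite zP; apply/existsP; exists (rel_at z y).
by rewrite zQ int_num_neq0 ?rel_at_in //; apply/existsP; exists z; rewrite !eqxx.
Qed.

(** The number of intermediate points of a given type depends only on the relation, so being nonzero
    at one pair it is nonzero at the other. *)
Lemma rel_path x y x' y' z : rel_at x y = rel_at x' y' ->
  exists z', rel_at x z = rel_at x' z' /\ rel_at z y = rel_at z' y'.
Proof.
move=> e; have : [exists z', (rel_at x' z' == rel_at x z) && (rel_at z' y' == rel_at z y)].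
  rewrite -int_num_neq0 ?rel_at_in // -e int_num_neq0 ?rel_at_in //.
  by apply/existsP; exists z; rewrite !eqxx.
by case/existsP=> z' /andP[/eqP <- /eqP <-]; exists z'.
Qed.

(** This is [rel_path] for the diagonal pairs at [x] and [x'], which both lie in [rel_id]. *)
Lemma rel_out x y x' : exists y', rel_at x' y' = rel_at x y.
Proof.
have [|z [-> _]] := @rel_path x x x' x' y; last by exists z.
by have /eqP-> : rel_at x x == rel_id X; [rewrite rel_at_id | apply/esym/eqP; rewrite rel_at_id].
Qed.

Lemma rel_into x y y' : exists x', rel_at x' y' = rel_at x y.
Proof. by have [x' /rel_at_sym] := rel_out y x y'; exists x'. Qed.

Lemma valency_rel x y : valency (rel_at x y) = #|[set z | rel_at x z == rel_at x y]|.
Proof.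
rewrite /valency -(eqP (_ : rel_at x x == rel_id X)) ?rel_at_id // rel_inv_at.
rewrite int_numE ?rel_at_in //; apply: eq_card => z; rewrite !inE.
by case: eqP => //= /rel_at_sym ->; rewrite eqxx.
Qed.

Lemma valency_eq1 s x y : s \in S -> valency s = 1%N ->
  rel_at x y = s -> forall z, (rel_at x z == s) = (z == y).
Proof.
move=> _ v1 es; move: v1; rewrite -{}es => /eqP; rewrite valency_rel => /cards1P[w /setP wE] z.
by have := wE z; rewrite !inE => ->; have := wE y; rewrite !inE eqxx => /esym/eqP ->.
Qed.

End Scheme.

(** * Thin closed subsets as semiregular group actions on the points *)

Section ThinGroup.

Variables (X : finType) (S : {set {set X * X}}).
Hypothesis hS : association_scheme S.
Variables (T : {set {set X * X}}) (gT : finGroupType) (E : {group gT}).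
Local Notation rel_at := (rel_at S).

(* A thin closed subset T isomorphic to E, seen as a semiregular right action
   of E on X: the relation f a is the graph of x |-> act x a. *)
Record thin_action (f : gT -> {set X * X}) (act : X -> gT -> X) : Prop :=
  ThinAction {
    thin_sub : T \subset S;
    thin_inj : {in E &, injective f};
    thin_im : f @: E = T;
    thin_act1 : forall x, act x 1%g = x;
    thin_actM : {in E &, forall a b x, act x (a * b)%g = act (act x a) b};
    thin_actP : {in E, forall a x y, (rel_at x y == f a) = (y == act x a)}
  }.

Lemma thin_isog_action : thin_isog S T E ->
  exists f act, thin_action f act.
Proof.
case=> /andP[cT /'forall_implyP thT] [f [injf fE fM]].
have TS : T \subset S by case/and3P: cT.
have fT a : a \in E -> f a \in T by move=> aE; rewrite -fE imset_f.
have fS a : a \in E -> f a \in S by move/fT; apply: subsetP.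
pose act x a := odflt x [pick y | rel_at x y == f a].
have actP : {in E, forall a x y, (rel_at x y == f a) = (y == act x a)}.
  move=> a aE x y; rewrite /act; case: pickP => [z /eqP ez | /= none].
    by apply: (valency_eq1 hS) => //; [exact: fS | exact/eqP/thT/fT].
  have [u [v uv]] := rel_atP hS (fS a aE).
  by have [z zP] := rel_out hS u v x; have := none z; rewrite zP uv eqxx.
have actM : {in E &, forall a b x, act x (a * b)%g = act (act x a) b}.
  move=> a b aE bE x; apply/esym/eqP; rewrite -actP ?groupM //.
  rewrite -(mem_rel_at hS) ?fS ?groupM // fM // inE; apply/existsP; exists (act x a).
  by rewrite !(mem_rel_at hS) ?fS // !actP // !eqxx.
(* The map [act^~ 1] is idempotent, so [f 1] contains a diagonal pair [(y, y)] and is therefore the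
   identity relation. *)
exists f, act; split=> // x; set y := act x 1%g.
have yy : act y 1%g = y by rewrite /y -actM // mulg1.
have: rel_at y y == f 1%g by rewrite actP // yy.
rewrite (eqP (_ : rel_at y y == rel_id X)) ?(rel_at_id hS) // => /eqP e1.
by apply/esym/eqP; rewrite -[_ == _](rel_at_id hS) e1 actP.
Qed.

End ThinGroup.

(** * The grading by the quotient scheme *)

Section Grading.

Variables (X : finType) (S : {set {set X * X}}).
Hypothesis hS : association_scheme S.
Variables (T : {set {set X * X}}) (gT : finGroupType) (E : {group gT}).
Local Notation rel_at := (rel_at S).

Variables (f : gT -> {set X * X}) (act : X -> gT -> X).
Hypothesis fact : thin_action S T E f act.

Lemma thin_memT x y : reflect (exists2 a, a \in E & y = act x a) (rel_at x y \in T).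
Proof.
rewrite -(thin_im fact); apply: (iffP imsetP) => -[a aE /eqP e]; exists a => //.
  by apply/eqP; rewrite -(thin_actP fact).
by apply/eqP; rewrite (thin_actP fact).
Qed.

Lemma act_relT x a : a \in E -> rel_at x (act x a) \in T.
Proof. by move=> aE; apply/thin_memT; exists a. Qed.

Lemma thin_actK a : a \in E -> cancel (act^~ a) (act^~ a^-1%g).
Proof.
by move=> aE x; rewrite -(thin_actM fact) ?groupV // mulgV (thin_act1 fact).
Qed.

Lemma thin_actVK a : a \in E -> cancel (act^~ a^-1%g) (act^~ a).
Proof. by move=> aE x; rewrite -{2}[a]invgK thin_actK ?groupV. Qed.

Lemma relT_refl x : rel_at x x \in T.
Proof. by apply/thin_memT; exists 1%g; rewrite ?(thin_act1 fact). Qed.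

Lemma relT_sym x y : rel_at x y \in T -> rel_at y x \in T.
Proof.
by case/thin_memT=> a aE ->; apply/thin_memT; exists a^-1%g; rewrite ?groupV ?thin_actK.
Qed.

Lemma relT_trans y x z : rel_at x y \in T -> rel_at y z \in T -> rel_at x z \in T.
Proof.
case/thin_memT=> a aE -> /thin_memT[b bE ->]; apply/thin_memT.
by exists (a * b)%g; rewrite ?groupM // (thin_actM fact).
Qed.

Lemma mem_coset_at (P : {set {set X * X}}) x y :
  P \subset S -> (y \in coset_at P x) = (rel_at x y \in P).
Proof.
move=> /subsetP PS; apply/bigcupP/idP => [[t tP] | xyP].
  by rewrite inE (mem_rel_at hS) ?PS // => /eqP ->.
by exists (rel_at x y); rewrite // inE (mem_rel_at hS) ?(rel_at_in hS).
Qed.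

Lemma coset_at_in x : coset_at T x \in cosets T.
Proof. exact: imset_f. Qed.

Definition coset_cls x : quo T :=
  exist _ (coset_at T x) (coset_at_in x).

Lemma coset_clsP (i : quo T) : exists x, i = coset_cls x.
Proof.
by case: i => A Ai; have /imsetP[x _ e] := Ai; exists x; apply: val_inj.
Qed.

Lemma mem_coset_cls x y : (y \in sval (coset_cls x)) = (rel_at x y \in T).
Proof. by rewrite mem_coset_at ?(thin_sub fact). Qed.

Lemma coset_cls_eq x y : (coset_cls x == coset_cls y) = (rel_at x y \in T).
Proof.
apply/eqP/idP => [e | xy]; first by rewrite -mem_coset_cls e mem_coset_cls relT_refl.
apply/val_inj/setP => z; rewrite -!/(sval _) !mem_coset_cls.
by apply/idP/idP; apply: relT_trans => //; apply: relT_sym.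
Qed.

Lemma cprodS (P Q : {set {set X * X}}) : cprod S P Q \subset S.
Proof. by apply/subsetP => s; rewrite inE => /andP[]. Qed.

Lemma quo_relP s x y : s \in S ->
  reflect (exists a b, [/\ rel_at x a \in T, rel_at b y \in T & rel_at a b = s])
          ((coset_cls x, coset_cls y) \in quo_rel S T s).
Proof.
move=> sS; have TS := thin_sub fact; have sS' : [set s] \subset S by rewrite sub1set.
rewrite inE /=; apply: (iffP existsP) => [[x1 /existsP[y1 /and3P[xx yy]]] | [a [b [xa yb ab]]]].
  rewrite mem_coset_at ?cprodS //.
  have /eqP : coset_cls x = coset_cls x1 by apply/val_inj/eqP.
  have /eqP : coset_cls y = coset_cls y1 by apply/val_inj/eqP.
  rewrite !coset_cls_eq => yT xT /cprod_rel-/(_ hS (cprodS _ _) TS)[b].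
  move=> /cprod_rel-/(_ hS TS sS')[a aT]; rewrite inE => /eqP ab bT.
  by exists a, b; split=> //; [apply: relT_trans aT | apply: relT_trans bT (relT_sym yT)].
exists x; apply/existsP; exists y; rewrite !eqxx mem_coset_at ?cprodS //=.
apply/cprod_rel; rewrite ?cprodS //; exists b => //.
by apply/cprod_rel => //; exists a; rewrite // inE ab.
Qed.

Lemma quo_rel_at x y : (coset_cls x, coset_cls y) \in quo_rel S T (rel_at x y).
Proof. by apply/quo_relP; rewrite ?(rel_at_in hS) //; exists x, y; rewrite !relT_refl. Qed.

(** A pair in [s] and a pair in [u] between the same two cosets are joined by steps in T at both
    ends; carrying these steps along to any other pair in [s] gives a pair in [u] between the cosets
    of that pair. *)
Lemma quo_rel_sub s u x y : s \in S -> u \in S ->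
  (coset_cls x, coset_cls y) \in quo_rel S T s ->
  (coset_cls x, coset_cls y) \in quo_rel S T u ->
  quo_rel S T s \subset quo_rel S T u.
Proof.
move=> sS uS /quo_relP-/(_ sS)[a [b [xa yb ab]]] /quo_relP-/(_ uS)[a' [b' [xa' yb' ab']]].
apply/subsetP => -[i j]; have [c ->] := coset_clsP i; have [d ->] := coset_clsP j.
move=> /quo_relP-/(_ sS)[c0 [d0 [cT dT cd]]]; apply/quo_relP => //.
have [|c1 [ac ad]] := @rel_path _ _ hS a b c0 d0 a'; first by rewrite ab.
have [d1 [e1 e2]] := rel_path hS b' ad.
have bbT : rel_at b' b \in T by apply: relT_trans yb' (relT_sym yb).
have aaT : rel_at a a' \in T by apply: relT_trans xa'; apply: relT_sym.
exists c1, d1; split; last by rewrite -e1.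
- by apply: relT_trans cT _; rewrite -ac.
- by apply: relT_trans dT; rewrite -e2.
Qed.

Lemma quo_rel_eq s u x y : s \in S -> u \in S ->
  (coset_cls x, coset_cls y) \in quo_rel S T s ->
  (coset_cls x, coset_cls y) \in quo_rel S T u -> quo_rel S T s = quo_rel S T u.
Proof.
move=> sS uS hs hu; apply/eqP; rewrite eqEsubset.
by apply/andP; split; [exact: (quo_rel_sub sS uS hs) | exact: (quo_rel_sub uS sS hu)].
Qed.

(** The quotient map onto the group S//T, written as a cocycle on pairs of points: [deg x y] is the
    class of the relation containing [(x, y)]. *)
Record grading (hT : finGroupType) (G : {group hT}) (deg : X -> X -> hT) : Prop :=
  Grading {
    deg_in : forall x y, deg x y \in G;
    degM : forall x y z, (deg x y * deg y z = deg x z)%g;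
    deg_rel : forall x y x' y', rel_at x y = rel_at x' y' -> deg x y = deg x' y';
    deg_eq1 : forall x y, (deg x y == 1%g) = (rel_at x y \in T);
    deg_surj : forall x a, a \in G -> exists y, deg x y = a
  }.

Lemma quotient_grading (hT : finGroupType) (G : {group hT}) :
  thin_isog (quo_rels S T) (quo_rels S T) G -> exists deg, grading G deg.
Proof.
case=> _ [h [injh hG hM]].
have h_sT a : a \in G -> exists2 s, s \in S & h a = quo_rel S T s.
  by move=> aG; apply/imsetP; rewrite -/(quo_rels S T) -hG imset_f.
have s_h s : s \in S -> exists2 a, a \in G & quo_rel S T s = h a.
  by move=> sS; apply/imsetP; rewrite hG; apply: imset_f.
(* The default is never reached, since the quotient relation through the two cosets is some
   [h a]. *)
pose deg x y := odflt 1%g [pick a in G | (coset_cls x, coset_cls y) \in h a].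
have degP x y : deg x y \in G /\ (coset_cls x, coset_cls y) \in h (deg x y).
  rewrite /deg; case: pickP => [a /andP[] // | /=].
  have [a aG e] := s_h _ (rel_at_in hS x y).
  by move/(_ a); rewrite aG -e quo_rel_at.
have degU x y a : a \in G -> (coset_cls x, coset_cls y) \in h a -> deg x y = a.
  move=> aG ha; have [dG hd] := degP x y; apply: injh => //.
  have [s sS hs] := h_sT _ dG; have [u uS hu] := h_sT _ aG.
  rewrite hs in hd; rewrite hu in ha; rewrite hs hu.
  exact: (quo_rel_eq sS uS hd ha).
have degG x y : deg x y \in G by case: (degP x y).
have degMul x y z : (deg x y * deg y z = deg x z)%g.
  apply/esym/degU; first by rewrite groupM.
  rewrite hM // inE; apply/existsP; exists (coset_cls y).
  by rewrite (degP x y).2 (degP y z).2.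
have deg_rels x y x' y' : rel_at x y = rel_at x' y' -> deg x y = deg x' y'.
  move=> e; have [a aG ea] := s_h _ (rel_at_in hS x y).
  rewrite (degU x y a aG) -?ea ?quo_rel_at //.
  by rewrite (degU x' y' a aG) // -ea e quo_rel_at.
have deg_xx x : deg x x = 1%g.
  by apply: (mulgI (deg x x)); rewrite degMul mulg1.
exists deg; split=> // x.
  move=> y; have [s sS hs] := h_sT _ (group1 G).
  (* [h 1] contains a diagonal pair of cosets, so it is the quotient relation of the identity, which
     relates each coset only to itself. *)
  have := (degP x x).2; rewrite deg_xx hs => xx.
  apply/eqP/idP => [d1 | xyT].
    have := (degP x y).2; rewrite d1 hs (quo_rel_eq sS (rel_at_in hS x x) xx (quo_rel_at x x)).
    case/(quo_relP _ _ (rel_at_in hS x x)) => a [b [xa yb ab]].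
    have: rel_at a b == rel_id X by rewrite ab (rel_at_id hS).
    by rewrite (rel_at_id hS) => /eqP eab; apply: relT_trans xa _; rewrite eab.
  apply: degU => //; rewrite hs.
  by have /eqP<- : coset_cls x == coset_cls y by rewrite coset_cls_eq.
move=> a aG; have [s sS hs] := h_sT _ aG; have [u [v uv]] := rel_atP hS sS.
have [y xy] := rel_out hS u v x; exists y; apply: degU => //.
by rewrite hs uv -xy quo_rel_at.
Qed.

End Grading.

(** Closure under products reaches all positive powers of [x], and these exhaust a group of prime
    order, the identity included. *)
Lemma prime_group_gen (gT : finGroupType) (G : {group gT}) (P : gT -> Prop) x :
  prime #|G| -> x \in G -> x != 1%g -> P x ->
  {in G &, forall a b, P a -> P b -> P (a * b)%g} -> {in G, forall a, P a}.
Proof.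
move=> prG xG x1 Px PM a aG.
have GE : <[x]>%g = G.
  apply/eqP; rewrite eqEcard cycle_subG xG /=.
  have /(primeP prG).2/pred2P[e|->//] : (#|<[x]>%g| %| #|G|)%N by rewrite cardSg ?cycle_subG.
  by move: x1; rewrite -order_eq1 /order e.
have Pexp k : P (x ^+ k.+1)%g.
  by elim: k => [|k IHk]; rewrite ?expg1 // expgS; apply: PM; rewrite ?groupX.
move: aG; rewrite -GE => /cycleP[k ->].
(* Adding the order of [x] to the exponent makes it positive. *)
by have := Pexp (k + #[x]%g).-1%N; rewrite prednK ?addn_gt0 ?order_gt0 ?orbT // expgD expg_order mulg1.
Qed.

(** * Stabilisers and strong normality *)

Section Combinatorics.

Variables (X : finType) (S : {set {set X * X}}).
Hypothesis hS : association_scheme S.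
Variables (T : {set {set X * X}}) (gT : finGroupType) (E : {group gT}).
Local Notation rel_at := (rel_at S).
Variables (f : gT -> {set X * X}) (act : X -> gT -> X).
Hypothesis fact : thin_action S T E f act.
Variables (hT : finGroupType) (G : {group hT}) (deg : X -> X -> hT).
Hypothesis gr : grading S T G deg.

Lemma deg_refl x : deg x x = 1%g.
Proof. by apply/eqP; rewrite (deg_eq1 gr) (relT_refl fact). Qed.

Lemma deg_inv x y : deg y x = (deg x y)^-1%g.
Proof. by apply/eqP; rewrite eq_sym eq_invg_mul (degM gr) deg_refl. Qed.

Lemma deg_act x a : a \in E -> deg x (act x a) = 1%g.
Proof. by move=> aE; apply/eqP; rewrite (deg_eq1 gr) (act_relT fact). Qed.

Lemma deg_actl x y a : a \in E -> deg (act x a) y = deg x y.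
Proof. by move=> aE; rewrite -(degM gr x (act x a)) deg_act // mul1g. Qed.

Lemma deg_actr x y a : a \in E -> deg x (act y a) = deg x y.
Proof. by move=> aE; rewrite -(degM gr x y) deg_act // mulg1. Qed.

Lemma deg1_act x y : deg x y = 1%g -> exists2 a, a \in E & y = act x a.
Proof. by move/eqP; rewrite (deg_eq1 gr) => /(thin_memT fact). Qed.

Lemma rel_at_act x a : a \in E -> rel_at x (act x a) = f a.
Proof. by move=> aE; apply/eqP; rewrite (thin_actP fact). Qed.

Lemma act_free x a b : a \in E -> b \in E -> act x a = act x b -> a = b.
Proof.
by move=> aE bE e; apply: (thin_inj fact) => //; rewrite -!(rel_at_act x) // e.
Qed.

(** [act x a] is the only point to which [x] is in relation [f a], so [rel_path] must carry it to
    [act x' a]. *)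
Lemma rel_actl a x y x' y' : a \in E ->
  rel_at x y = rel_at x' y' -> rel_at (act x a) y = rel_at (act x' a) y'.
Proof.
move=> aE e; have [z [/esym/eqP + ->]] := rel_path hS (act x a) e.
by rewrite rel_at_act // (thin_actP fact) // => /eqP ->.
Qed.

Lemma rel_actr a x y x' y' : a \in E ->
  rel_at x y = rel_at x' y' -> rel_at x (act y a) = rel_at x' (act y' a).
Proof.
by move=> aE /(rel_at_sym hS)/(rel_actl aE)/(rel_at_sym hS).
Qed.

(** Move the second pair inside its relation to some [(z, y)]; then [z] and [x] have the same degree
    to [y] and lie in one coset of T. *)
Lemma same_deg_l x y x' y' : deg x y = deg x' y' ->
  exists2 a, a \in E & rel_at x' y' = rel_at (act x a) y.
Proof.
move=> e; have [z zy] := rel_into hS x' y' y.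
have [|a aE za] := @deg1_act x z; last by exists a; rewrite -?za.
by rewrite -(degM gr x y) e (deg_inv z y) (deg_rel gr zy) mulgV.
Qed.

Definition lstabE x y := [set a in E | rel_at (act x a) y == rel_at x y].

Lemma lstabE_rel x y x' y' : rel_at x y = rel_at x' y' -> lstabE x y = lstabE x' y'.
Proof.
move=> e; apply/setP => a; rewrite !inE; case aE: (a \in E) => //=.
by rewrite (rel_actl aE e) e.
Qed.

Lemma group_set_lstabE x y : group_set (lstabE x y).
Proof.
apply/group_setP; split=> [|a b]; first by rewrite inE group1 (thin_act1 fact) /=.
rewrite !inE => /andP[aE /eqP ea] /andP[bE /eqP eb]; rewrite groupM //=.
by rewrite (thin_actM fact) // (rel_actl bE ea) eb.
Qed.
Canonical lstabE_group x y := Group (group_set_lstabE x y).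

Lemma lstabE_sub x y : lstabE x y \subset E.
Proof. by apply/subsetP => a; rewrite inE => /andP[]. Qed.

(** Translating [y] back to [x] reduces to the identity relation, whose stabiliser is trivial
    because E acts freely. *)
Lemma lstabE_trivial x y : deg x y = 1%g -> lstabE x y = 1%g.
Proof.
case/deg1_act=> b bE ->; apply/eqP; rewrite eqEsubset sub1G andbT.
apply/subsetP => a; rewrite !inE => /andP[aE /eqP e].
have := rel_actr (groupVr bE) e; rewrite !(thin_actK fact) // => /eqP.
rewrite [rel_at x x](eqP (_ : _ == rel_id X)) (rel_at_id hS) // => /eqP ax.
by apply/eqP/(@act_free x); rewrite ?(thin_act1 fact).
Qed.

Lemma lstabE_into x y z : rel_at z y = rel_at x y ->
  exists2 a, a \in lstabE x y & z = act x a.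
Proof.
move=> e; have [|a aE za] := @deg1_act x z.
  by rewrite -(degM gr x y) (deg_inv z y) (deg_rel gr e) mulgV.
by exists a; rewrite // inE aE -za e eqxx.
Qed.

(** Strong normality phrased on points: the last hypothesis is the inclusion of s^* K s in K, as
    [(a, x)] and [(b, y)] lie in one relation s. *)
Lemma strongly_normalI (K : {set {set X * X}}) : K \subset S -> rel_id X \in K ->
  (forall x y z, rel_at x y \in K -> rel_at y z \in K -> rel_at x z \in K) ->
  (forall x y a b, rel_at a x = rel_at b y -> rel_at a b \in K -> rel_at x y \in K) ->
  strongly_normal S K.
Proof.
move=> KS K1 KK KN; apply/andP; split.
  rewrite /closed_subset KS /=; apply/andP; split.
    by apply/set0Pn; exists (rel_id X).
  apply/subsetP => w wK; have wS : w \in S by case/setIdP: wK.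
  have [x [y e]] := rel_atP hS wS; move: wK; rewrite {}e.
  by case/(cprod_rel hS _ _ KS KS) => z; apply: KK.
apply/forall_inP => s sS; apply/subsetP => w wK; have wS : w \in S by case/setIdP: wK.
have [x [y e]] := rel_atP hS wS; move: wK; rewrite {}e.
have sS1 : [set s] \subset S by rewrite sub1set.
have sS2 : [set rel_inv s] \subset S by rewrite sub1set; case: hS => _ _ _ ->.
case/(cprod_rel hS _ _ (cprodS _ _ _) sS1) => b.
case/(cprod_rel hS _ _ sS2 KS) => a; rewrite !inE => /eqP xa ab /eqP bs.
apply: KN ab; rewrite bs; apply/eqP; rewrite -(mem_rel_at hS) //.
by have := mem_rel_at hS x a (rel_at_in hS x a); rewrite eqxx xa inE.
Qed.

Lemma thin_in_T a : a \in E -> f a \in T.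
Proof. by move=> aE; rewrite -(thin_im fact) imset_f. Qed.

Lemma thin_in a : a \in E -> f a \in S.
Proof. by move/thin_in_T; apply: (subsetP (thin_sub fact)). Qed.

Lemma mem_thin a x y : a \in E -> ((x, y) \in f a) = (y == act x a).
Proof. by move=> aE; rewrite (mem_rel_at hS) ?thin_in // (thin_actP fact). Qed.

Lemma thin_f1 : f 1%g = rel_id X.
Proof. by apply/setP => -[x y]; rewrite mem_thin // (thin_act1 fact) inE eq_sym. Qed.

Lemma thin_fM a b : a \in E -> b \in E -> f (a * b)%g = rel_mul (f a) (f b).
Proof.
move=> aE bE; apply/setP => -[x y]; rewrite mem_thin ?groupM // inE (thin_actM fact) //=.
apply/eqP/existsP => [-> | [z]]; first by exists (act x a); rewrite !mem_thin ?eqxx.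
by rewrite !mem_thin // => /andP[/eqP-> /eqP].
Qed.

Lemma thin_fV a : a \in E -> f a^-1%g = rel_inv (f a).
Proof.
move=> aE; apply/setP => -[x y]; rewrite inE !mem_thin ?groupV //.
by apply/eqP/eqP => /= ->; rewrite ?(thin_actK fact) ?(thin_actVK fact).
Qed.

Lemma lstab_rel x y : lstab S T (rel_at x y) = f @: lstabE x y.
Proof.
have xyS : [set rel_at x y] \subset S by rewrite sub1set rel_at_in.
have cprodE a c d : a \in E ->
    rel_at c d \in cprod S [set f a] [set rel_at x y] = (rel_at (act c a) d == rel_at x y).
  move=> aE; have aS : [set f a] \subset S by rewrite sub1set thin_in.
  apply/(cprod_rel hS _ _ aS xyS)/eqP => [[z] | e].
    by rewrite !inE (thin_actP fact) // => /eqP-> /eqP.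
  by exists (act c a); rewrite inE ?e // rel_at_act.
apply/setP => t; apply/setIdP/imsetP => [[] | [a]].
  rewrite -{1}(thin_im fact) => /imsetP[a aE ->] /eqP/setP/(_ (rel_at x y)).
  rewrite cprodE // in_set1 eqxx => e; exists a => //.
  by rewrite inE aE.
rewrite inE => /andP[aE /eqP ea] ->; split; first exact: thin_in_T.
apply/eqP/setP => w; rewrite in_set1; case wS : (w \in S); last first.
  rewrite inE wS; apply/esym; apply: contraFF wS => /eqP ->; exact: rel_at_in.
have [c [d ->]] := rel_atP hS wS; rewrite cprodE //.
apply/eqP/eqP => [e | /(rel_actl aE) -> //].
by have := rel_actl (groupVr aE) (etrans e (esym ea)); rewrite !(thin_actK fact).
Qed.

(** Moving [x] conjugates the stabiliser, which commutativity makes harmless; moving [y] commutes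
    with the action on the left. *)
Lemma lstabE_act x y a b : abelian E -> a \in E -> b \in E ->
  lstabE (act x a) (act y b) = lstabE x y.
Proof.
move=> /centsP cEE aE bE; apply/setP => c; rewrite !inE; case cE : (c \in E) => //=.
rewrite -(thin_actM fact) // (cEE a aE c cE) (thin_actM fact) //.
apply/eqP/eqP => [/(rel_actl (groupVr aE))/(rel_actr (groupVr bE)) | e].
  by rewrite !(thin_actK fact).
by apply/rel_actl/rel_actr.
Qed.

(** Any relation meeting the two cosets contains a pair [(act x a, act y b)], so the choice made by
    [pick] does not matter; the relation of [(x, y)] shows that one exists. *)
Lemma lstab_ptsE x y : abelian E ->
  lstab_pts S (coset_cls T x) (coset_cls T y) = f @: lstabE x y.
Proof.
move=> cE; rewrite /lstab_pts; case: pickP => [s /andP[sS] | /(_ (rel_at x y))].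
  case/set0Pn=> -[c d] /setIP[]; rewrite (mem_rel_at hS) // => /eqP <- /setXP[].
  rewrite !(mem_coset_cls hS fact) => /(thin_memT fact)[a aE ->] /(thin_memT fact)[b bE ->].
  by rewrite lstab_rel lstabE_act.
rewrite rel_at_in //= => /negbFE/eqP/setP/(_ (x, y)).
rewrite inE in_setX !(mem_coset_cls hS fact) !(relT_refl fact) (mem_rel_at hS) ?rel_at_in //.
by rewrite eqxx inE.
Qed.

(** * Consequences of the minimality of T *)

Section Residue.

Hypothesis hmin : forall K, strongly_normal S K -> T \subset K.
Hypothesis prG : prime #|G|.

(* If one relation outside T has trivial stabiliser then, G having prime order,
   all do; S is then thin and its thin residue is trivial. *)
Lemma lstabE_neq1 x y : abelian E -> (1 < #|E|)%N -> deg x y != 1%g -> lstabE x y != 1%g.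
Proof.
move=> cEE E1 xy1; apply/eqP => xyL; move: E1; rewrite ltnNge => /negP; apply.
pose P a := forall u v, deg u v = a -> lstabE u v = 1%g.
have Pall : {in G, forall a, P a}.
  apply: (prime_group_gen prG _ xy1); first exact: (deg_in gr).
    move=> u v /esym/same_deg_l[a aE /lstabE_rel ->].
    by rewrite -[y](thin_act1 fact) lstabE_act.
  move=> a b aG bG Pa Pb u v uv; have [w uw] := deg_surj gr u aG.
  have wv : deg w v = b by apply: (mulgI a); rewrite -uv -(degM gr u w) uw.
  (* If [c] stabilises the relation of [(u, v)], the path through [w] is carried to one from
     [act u c] through some [w']. Triviality in degree [b] forces [w' = w], and triviality in degree
     [a] then forces [c = 1]. *)
  apply/trivgP/subsetP => c; rewrite inE => /andP[cE /eqP/esym e].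
  have [w' [e1 /esym/lstabE_into[d]]] := rel_path hS w e.
  rewrite (Pb _ _ wv) => /set1gP -> w'E; rewrite w'E (thin_act1 fact) in e1.
  by rewrite -(Pa _ _ uw) inE cE e1 eqxx.
(* With all stabilisers trivial, two points to which [a] is in the same relation coincide. *)
have /hmin TK : strongly_normal S [set rel_id X].
  apply: strongly_normalI.
  - by rewrite sub1set; case: hS.
  - exact: set11.
  - by move=> u v w; rewrite !inE !(rel_at_id hS) => /eqP ->.
  move=> u v a b e; rewrite !inE !(rel_at_id hS) => /eqP ab; rewrite -{}ab in e.
  have [c] := lstabE_into (esym (rel_at_sym hS e)).
  by rewrite (Pall (deg u a)) ?(deg_in gr) // => /set1gP -> ->; rewrite (thin_act1 fact).
by rewrite -(card_in_imset (thin_inj fact)) (thin_im fact) -(cards1 (rel_id X)) subset_leq_card.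
Qed.

End Residue.

End Combinatorics.

(** A proper subgroup has order at most p, a nontrivial one at least p. *)
Lemma psquare_subgroup_eq (gT : finGroupType) (E H K : {group gT}) p :
  prime p -> #|E| = (p ^ 2)%N -> H \subset K -> K \proper E -> H :!=: 1%g -> H :=: K.
Proof.
move=> pr_p cardE sHK pKE H1; apply/eqP; rewrite eqEcard sHK /=.
have sKE := proper_sub pKE; have /(dvdn_pfactor _ _ pr_p)[k k2 cardK] : (#|K| %| p ^ 2)%N.
  by rewrite -cardE cardSg.
have /(dvdn_pfactor _ _ pr_p)[h h2 cardH] : (#|H| %| p ^ 2)%N.
  by rewrite -cardE cardSg // (subset_trans sHK).
move: (proper_card pKE) H1; rewrite -cardG_gt1 cardK cardE cardH.
have p1 := prime_gt1 pr_p; rewrite ltn_exp2l // leq_exp2l // => k1.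
by case: h {h2 cardH} => // h _; apply: leq_trans (_ : k <= 1)%N _.
Qed.

(** * Characters of T in a module *)

Section Modules.

Variables (X : finType) (S : {set {set X * X}}).
Hypothesis hS : association_scheme S.
Variables (T : {set {set X * X}}) (gT : finGroupType) (E : {group gT}).
Local Notation rel_at := (rel_at S).
Variables (f : gT -> {set X * X}) (act : X -> gT -> X).
Hypothesis fact : thin_action S T E f act.
Variables (hT : finGroupType) (G : {group hT}) (deg : X -> X -> hT).
Hypothesis gr : grading S T G deg.
Local Notation lstabE := (lstabE S E act).

Variables (C : numClosedFieldType) (n : nat) (A : {set X * X} -> 'M[C]_n).

(** Stated on the basis of adjacency matrices only, so that irreducible representations and the
    standard module C^X are both instances. *)
Record scheme_module : Prop := SchemeModule {
  module1 : A (rel_id X) = 1%:M;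
  moduleM : {in S &, forall s u,
    A s *m A u = \sum_(w in S) (int_num s u w)%:R *: A w}
}.
Hypothesis hA : scheme_module.

(** Since [f a] is thin, exactly one structure constant of the product is nonzero, and it equals
    1. *)
Lemma module_actl x y a : a \in E ->
  A (f a) *m A (rel_at (act x a) y) = A (rel_at x y).
Proof.
move=> aE; rewrite (moduleM hA) ?rel_at_in ?(thin_in fact) // (bigD1 (rel_at x y)) ?rel_at_in //=.
have numE c d : int_num (f a) (rel_at (act x a) y) (rel_at c d) =
    (rel_at (act c a) d == rel_at (act x a) y).
  rewrite int_numE ?rel_at_in ?(thin_in fact) //.
  rewrite (_ : [set z | _] = if rel_at (act c a) d == rel_at (act x a) y
                             then [set act c a] else set0).
    by case: ifP; rewrite ?cards1 ?cards0.
  apply/setP => z; rewrite inE (thin_actP fact) //.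
  by case: (z =P act c a) => [-> | /eqP/negPf zc]; case: ifP; rewrite !inE ?eqxx ?zc.
rewrite numE eqxx scale1r big1 ?addr0 // => w /andP[wS].
have [c [d ->]] := rel_atP hS wS; rewrite numE => neq.
case: eqP => [/(rel_actl hS fact (groupVr aE)) | _]; last by rewrite scale0r.
by rewrite !(thin_actK fact) // => e; rewrite e eqxx in neq.
Qed.

Lemma module_actr x y a : a \in E ->
  A (rel_at x y) *m A (f a) = A (rel_at x (act y a)).
Proof.
move=> aE; rewrite (moduleM hA) ?rel_at_in ?(thin_in fact) //.
rewrite (bigD1 (rel_at x (act y a))) ?rel_at_in //=.
have numE c d : int_num (rel_at x y) (f a) (rel_at c d) =
    (rel_at c (act d a^-1%g) == rel_at x y).
  rewrite int_numE ?rel_at_in ?(thin_in fact) //.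
  rewrite (_ : [set z | _] = if rel_at c (act d a^-1%g) == rel_at x y
                             then [set act d a^-1%g] else set0).
    by case: ifP; rewrite ?cards1 ?cards0.
  apply/setP => z; rewrite inE (thin_actP fact) //.
  rewrite (_ : (d == act z a) = (z == act d a^-1%g)).
    by case: (z =P act d a^-1%g) => [-> | /eqP/negPf zd]; case: ifP; rewrite !inE ?eqxx ?zd ?andbF.
  by apply/eqP/eqP => ->; rewrite ?(thin_actK fact) ?(thin_actVK fact).
rewrite numE (thin_actK fact) // eqxx scale1r big1 ?addr0 // => w /andP[wS].
have [c [d ->]] := rel_atP hS wS; rewrite numE => neq.
case: eqP => [/(rel_actr hS fact aE) | _]; last by rewrite scale0r.
by rewrite (thin_actVK fact) // => e; rewrite e eqxx in neq.
Qed.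

(** [lam] is a bare function; that it is a linear character of E follows from [v != 0]. *)
Definition weight_vec (lam : gT -> C) (v : 'rV[C]_n) : Prop :=
  v != 0 /\ {in E, forall a, v *m A (f a) = lam a *: v}.

Section Weight.

Variables (lam : gT -> C) (v : 'rV[C]_n).
Hypothesis hv : weight_vec lam v.

Lemma weight_actl x y a : a \in E ->
  v *m A (rel_at x y) = lam a *: (v *m A (rel_at (act x a) y)).
Proof.
by move=> aE; rewrite -(module_actl x y aE) mulmxA (hv.2 _ aE) -scalemxAl.
Qed.

Lemma weight1 : lam 1%g = 1.
Proof.
have := hv.2 _ (group1 E); rewrite (thin_f1 hS fact) (module1 hA) mulmx1 => /esym/eqP.
rewrite -{2}[v]scale1r -subr_eq0 -scalerBl scaler_eq0 (negPf hv.1) orbF subr_eq0.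
by move/eqP.
Qed.

Lemma module_fM a b : a \in E -> b \in E -> A (f (a * b)%g) = A (f a) *m A (f b).
Proof.
move=> aE bE; have [x _] : exists x : X, True.
  by case: hS => /card_gt0P[x _] _ _ _ _; exists x.
rewrite -(rel_at_act fact x aE) module_actr // -(thin_actM fact) //.
by rewrite (rel_at_act fact) ?groupM.
Qed.

Lemma weightM : {in E &, {morph lam : a b / (a * b)%g >-> a * b}}.
Proof.
move=> a b aE bE; have := hv.2 _ (groupM aE bE); rewrite module_fM // mulmxA.
rewrite (hv.2 _ aE) -scalemxAl (hv.2 _ bE) scalerA => /esym/eqP.
by rewrite -subr_eq0 -scalerBl scaler_eq0 (negPf hv.1) orbF subr_eq0 => /eqP.
Qed.

Lemma weight_neq0 a : a \in E -> lam a != 0.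
Proof.
move=> aE; apply/eqP => la0; have /eqP := weightM aE (groupVr aE).
by rewrite mulgV weight1 la0 mul0r oner_eq0.
Qed.

(** Relations of equal degree differ by a translation on the left, which [v] absorbs as a nonzero
    scalar. *)
Lemma weight_same_deg x y x' y' : deg x y = deg x' y' ->
  (v *m A (rel_at x' y') <= v *m A (rel_at x y))%MS.
Proof.
case/(same_deg_l hS fact gr) => a aE ->; rewrite (weight_actl x y aE).
by rewrite eqmx_scale ?weight_neq0.
Qed.

(** Every relation occurring in the product has degree [deg x z], so [v] is sent into one line by
    all of them. *)
Lemma weight_path x y z : (v *m A (rel_at x y) *m A (rel_at y z) <= v *m A (rel_at x z))%MS.
Proof.
rewrite -mulmxA (moduleM hA) ?rel_at_in // mulmx_sumr summx_sub // => w wS.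
have [c [d ->]] := rel_atP hS wS; rewrite -scalemxAr.
have [-> | ] := eqVneq (int_num (rel_at x y) (rel_at y z) (rel_at c d)) 0%N.
  by rewrite scale0r sub0mx.
rewrite int_num_neq0 ?rel_at_in // => /existsP[e /andP[/eqP e1 /eqP e2]].
apply/scalemx_sub/weight_same_deg.
by rewrite -(degM gr x y) -(degM gr c e) (deg_rel gr e1) (deg_rel gr e2).
Qed.

(** The relations occurring in the product of s and s^* are the [f a] with [a] in the stabiliser of
    s, which all fix [v]. The scalar is thus the sum of the structure constants, positive because
    the identity occurs. *)
Lemma weight_back x y : {in lstabE x y, forall a, lam a = 1} ->
  exists2 c, c != 0 & v *m A (rel_at x y) *m A (rel_at y x) = c *: v.
Proof.
move=> lam1; exists (\sum_(w in S) int_num (rel_at x y) (rel_at y x) w)%:R.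
  rewrite pnatr_eq0 (bigD1 (rel_at x x)) ?rel_at_in //= -lt0n addn_gt0 lt0n.
  by rewrite int_num_neq0 ?rel_at_in //; apply/orP; left; apply/existsP; exists y; rewrite !eqxx.
rewrite -mulmxA (moduleM hA) ?rel_at_in // mulmx_sumr natr_sum scaler_suml.
apply: eq_bigr => w wS; have [c [d ->]] := rel_atP hS wS; rewrite -scalemxAr.
have [-> | ] := eqVneq (int_num (rel_at x y) (rel_at y x) (rel_at c d)) 0%N.
  by rewrite !scale0r.
rewrite int_num_neq0 ?rel_at_in // => /existsP[e /andP[/eqP e1 /eqP e2]].
have [a] := lstabE_into fact gr (etrans (rel_at_sym hS e2) (esym e1)).
rewrite (lstabE_rel hS fact e1) => aL ->; have aE := subsetP (lstabE_sub _ _ _ _ _) _ aL.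
by rewrite (rel_at_act fact) // (hv.2 _ aE) lam1 // scale1r.
Qed.

(** An [a] stabilising the relation multiplies the image by [lam a], so a nonzero image forces
    [lam a = 1]; the converse is [weight_back]. *)
Lemma weight_stab x y :
  reflect {in lstabE x y, forall a, lam a = 1} (v *m A (rel_at x y) != 0).
Proof.
apply: (iffP idP) => [nz a | /weight_back[c c0 e]].
  rewrite inE => /andP[aE /eqP e]; have /eqP := weight_actl x y aE; rewrite e.
  rewrite -{1}[_ *m _]scale1r eq_sym -subr_eq0 -scalerBl scaler_eq0 (negPf nz) orbF.
  by rewrite subr_eq0 => /eqP.
apply/eqP => v0; move: e; rewrite v0 mul0mx => /esym/eqP.
by rewrite scaler_eq0 (negPf c0) (negPf hv.1).
Qed.

End Weight.

(* the character of E by which E acts on the image of a lam-vector under rel_at x y *)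
Definition twist (lam : gT -> C) x y a : C :=
  (lam (odflt 1%g [pick b in E | rel_at x (act y a) == rel_at (act x b) y]))^-1.

(** Translating [y] by [a] keeps the degree, hence amounts to translating [x] by some [b], which [v]
    absorbs. *)
Lemma weight_twist lam v x y : weight_vec lam v -> v *m A (rel_at x y) != 0 ->
  weight_vec (twist lam x y) (v *m A (rel_at x y)).
Proof.
move=> hv nz; split=> // a aE; rewrite -mulmxA module_actr // /twist.
case: pickP => [b /andP[bE /eqP ->] | /=].
  by rewrite [in RHS](weight_actl hv x y bE) scalerA mulVf ?scale1r ?(weight_neq0 hv).
have [|b bE e] := @same_deg_l _ _ hS _ _ _ _ _ fact _ _ _ gr x y x (act y a).
  by rewrite (deg_actr fact gr).
by move/(_ b); rewrite bE e eqxx.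
Qed.

Lemma weight_uniq lam mu v : weight_vec lam v -> weight_vec mu v -> {in E, lam =1 mu}.
Proof.
move=> hv hv' a aE; have /eqP := hv.2 _ aE; rewrite (hv'.2 _ aE) -subr_eq0 -scalerBl.
by rewrite scaler_eq0 (negPf hv.1) orbF subr_eq0 => /eqP.
Qed.

Lemma weight_ext lam mu v : {in E, lam =1 mu} -> weight_vec lam v -> weight_vec mu v.
Proof. by move=> e [v0 hv]; split=> // a aE; rewrite hv // e. Qed.

Lemma weight_sub lam u v : weight_vec lam u -> (u <= v)%MS -> weight_vec lam v.
Proof.
move=> [u0 hu] /sub_rVP[c uE]; have c0 : c != 0.
  by apply: contraNneq u0 => c0; rewrite uE c0 scale0r.
have -> : v = c^-1 *: u by rewrite uE scalerA mulVf ?scale1r.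
split=> [|a aE]; first by rewrite scaler_eq0 invr_eq0 (negPf c0).
by rewrite -scalemxAl hu // !scalerA mulrC.
Qed.

(** Both the vanishing of the image and its character depend on [lam] and the relation, not on the
    vector. *)
Lemma weight_transport lam mu v v' x y : weight_vec lam v -> weight_vec lam v' ->
  weight_vec mu (v *m A (rel_at x y)) -> weight_vec mu (v' *m A (rel_at x y)).
Proof.
move=> hv hv' hw; have lam1 := weight_stab hv x y hw.1.
apply: (weight_ext (weight_uniq (weight_twist hv hw.1) hw)).
by apply: weight_twist => //; apply/(weight_stab hv' x y).
Qed.

Hypothesis hmin : forall K, strongly_normal S K -> T \subset K.
Hypothesis prG : prime #|G|.

(* The degrees moving lam to itself are closed under products, so if one of them
   is nontrivial then all of S preserves lam, and ker lam is strongly normal. *)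
Lemma weight_fixed lam v x y : weight_vec lam v -> deg x y != 1%g ->
  weight_vec lam (v *m A (rel_at x y)) -> {in E, forall a, lam a = 1}.
Proof.
move=> hv xy1 hxy.
(* All vectors of weight [lam] are allowed, so that the image of one step can start the next. *)
pose P a := forall u w v', deg u w = a -> weight_vec lam v' -> weight_vec lam (v' *m A (rel_at u w)).
have Pall : {in G, forall a, P a}.
  apply: (prime_group_gen prG _ xy1); first exact: (deg_in gr).
    move=> u w v' e hv'; apply: weight_sub (weight_same_deg hv' e).
    exact: weight_transport hv hv' hxy.
  move=> a b aG bG Pa Pb u w v' uw hv'; have [z uz] := deg_surj gr u aG.
  have zw : deg z w = b by apply: (mulgI a); rewrite -uw -(degM gr u z) uz.
  by apply: weight_sub (weight_path hv' u z w); apply: Pb => //; apply: Pa.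
have kerP u w : reflect (exists2 a, a \in E & lam a = 1 /\ w = act u a)
    (rel_at u w \in f @: [set a in E | lam a == 1]).
  apply: (iffP imsetP) => [[a] | [a aE [la ->]]].
    rewrite inE => /andP[aE /eqP la] /eqP; rewrite (thin_actP fact) // => /eqP ->.
    by exists a.
  by exists a; rewrite ?inE ?aE ?la ?eqxx ?(rel_at_act fact).
have /hmin/subsetP TK : strongly_normal S (f @: [set a in E | lam a == 1]).
  apply: strongly_normalI => //.
  - by apply/subsetP => _ /imsetP[a /setIdP[aE _] ->]; apply: thin_in fact _ aE.
  - by rewrite -(thin_f1 hS fact) imset_f // inE group1 (weight1 hv) eqxx.
  - move=> u w z /kerP[a aE [la ->]] /kerP[b bE [lb ->]]; apply/kerP.
    by exists (a * b)%g; rewrite ?groupM // (weightM hv) // la lb mulr1 (thin_actM fact).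
  move=> u w a b e /kerP[c cE [lc bE]]; rewrite {}bE in e.
  have [|d dE wE] := @deg1_act _ _ _ _ _ _ _ fact _ _ _ gr u w.
    rewrite -(degM gr u a) (deg_inv fact gr a u) (deg_rel gr e).
    by rewrite (deg_actl fact gr) // mulVg.
  apply/kerP; exists d => //; split=> //; rewrite {}wE in e.
  (* Absorbing [c] shows that [f d] fixes the image of [v] under the relation of [(a, u)]; that
     image has weight [lam], so [lam d = 1]. *)
  have [y0 hy] := Pall _ (deg_in gr a u) a u v erefl hv.
  have := weight_actl hv a (act u d) cE; rewrite -e lc scale1r -(module_actr _ _ dE) mulmxA hy //.
  move/eqP; rewrite -{2}[v *m _]scale1r -subr_eq0 -scalerBl scaler_eq0 (negPf y0) orbF.
  by rewrite subr_eq0 => /eqP.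
move=> a aE; have := TK _ (thin_in_T fact aE); case: (hS) => /card_gt0P[u _] _ _ _ _.
rewrite -(rel_at_act fact u aE) => /kerP[b bE [lb /(act_free fact)]].
by move=> ->.
Qed.

(** If the two characters agree, the relation leading back from [z] to [x] also returns the image at
    [y] to weight [lam]. Were the degrees distinct, a nontrivial degree would preserve [lam],
    against [weight_fixed]. *)
Lemma twist_inj lam v x y z : weight_vec lam v ->
  ~ {in E, forall a, lam a = 1} ->
  v *m A (rel_at x y) != 0 -> v *m A (rel_at x z) != 0 ->
  {in E, twist lam x y =1 twist lam x z} -> deg x y = deg x z.
Proof.
move=> hv nontriv xy xz e; apply/eqP; apply: contra_notT nontriv => yz.
have hy := weight_ext e (weight_twist hv xy); have hz := weight_twist hv xz.
have [c c0 vc] := weight_back hv (weight_stab hv x z xz).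
have hzx : weight_vec lam (v *m A (rel_at x z) *m A (rel_at z x)).
  by apply: (weight_sub hv); rewrite vc eqmx_scale.
have [t yt] := rel_out hS z x y.
have hyt := weight_transport hz hy hzx; rewrite -yt in hyt.
apply: (weight_fixed hv _ (weight_sub hyt (weight_path hv x y t))).
rewrite -(degM gr x y) (deg_rel gr yt) (deg_inv fact gr x z).
by rewrite -eq_mulgV1.
Qed.

(** The vectors fixed by T form a submodule, hence everything. An eigenvector of a relation of
    nontrivial degree then spans a line stable under that degree, and so under all of G. *)
Lemma weight_triv_dim lam v : weight_vec lam v -> {in E, forall a, lam a = 1} ->
  (forall U : 'M[C]_n, {in S, forall s, stablemx U (A s)} -> U != 0 -> row_full U) ->
  n = 1%N.
Proof.
move=> hv triv irr; have n0 : (0 < n)%N.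
  by have := rank_leq_col v; rewrite rank_rV hv.1.
have [g gG g1] : exists2 g, g \in G & g != 1%g.
  apply/exists_inP; apply: contraTT (prime_gt1 prG) => /exists_inPn h.
  rewrite -leqNgt -trivg_card_le1; apply/eqP/trivgP/subsetP => a /h.
  by rewrite negbK inE.
have [x0 _] : exists x : X, True by case: hS => /card_gt0P[x _]; exists x.
have [y0 y0g] := deg_surj gr x0 gG.
pose fixed := (\bigcap_(a in E) kermx (A (f a) - 1%:M))%MS.
have fixedP (u : 'rV_n) : reflect {in E, forall a, u *m A (f a) = u} (u <= fixed)%MS.
  apply: (iffP sub_bigcapmxP) => h a aE; have := h a aE.
    by move/sub_kermxP/eqP; rewrite mulmxBr mulmx1 subr_eq0 => /eqP.
  by move=> e; apply/sub_kermxP; rewrite mulmxBr mulmx1 e subrr.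
have fixed_weight (u : 'rV_n) : u != 0 -> (u <= fixed)%MS -> weight_vec (fun=> 1) u.
  by move=> u0 /fixedP h; split=> // a aE; rewrite scale1r h.
have fixed_full : row_full fixed.
  apply: irr => [s sS | ]; last first.
    have : (v <= fixed)%MS by apply/fixedP => a aE; rewrite (hv.2 _ aE) triv // scale1r.
    by apply: contraTneq => ->; rewrite submx0 hv.1.
  apply/rV_subP => u /submxP[z]; rewrite mulmxA; set y := z *m fixed => uE.
  apply/fixedP => a aE; have [-> | u0] := eqVneq u 0; first by rewrite mul0mx.
  have y0' : y != 0 by apply: contraNneq u0 => e; rewrite uE e mul0mx.
  have [c [d es]] := rel_atP hS sS; rewrite es in uE.
  have hy := fixed_weight _ y0' (submxMl z fixed).
  have := (weight_twist hy (x := c) (y := d)); rewrite -uE => /(_ u0) hu.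
  by rewrite (hu.2 _ aE) /twist invr1 scale1r.
have [r /eigenvalueP[u ur u0]] := eigenvalue_closed (A (rel_at x0 y0)) n0.
have hu := fixed_weight _ u0 (submx_full u fixed_full).
have stab1 x y : u *m A (rel_at x y) != 0 by apply/(weight_stab hu).
have line_stab : {in G, forall a x y, deg x y = a -> (u *m A (rel_at x y) <= u)%MS}.
  apply: (prime_group_gen prG gG g1) => [x y e | a b aG bG Pa Pb x y xy].
    apply: submx_trans (weight_same_deg hu (x := x0) (y := y0) _) _; first by rewrite y0g e.
    by rewrite ur scalemx_sub.
  have [z xz] := deg_surj gr x aG.
  have zy : deg z y = b by apply: (mulgI a); rewrite -xy -(degM gr x z) xz.
  have /sub_rVP[c uxz] := Pa _ _ xz; have /sub_rVP[d uzy] := Pb _ _ zy.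
  (* The two-step image is a nonzero multiple of [u] and lies in the line of the one-step image, so
     the two lines coincide. *)
  have := weight_path hu x z y; rewrite uxz -scalemxAl uzy => /sub_rVP[e].
  rewrite scalerA => ue; have cd0 : c * d != 0.
    by apply: mulf_neq0; [move: (stab1 x z); rewrite uxz | move: (stab1 z y); rewrite uzy];
      rewrite scaler_eq0 negb_or => /andP[].
  have e0 : e != 0.
    apply: contraNneq cd0 => e0; move/eqP: ue; rewrite e0 scale0r scaler_eq0.
    by rewrite (negPf u0) orbF.
  by rewrite -(eqmx_scale _ e0) -ue scalemx_sub.
have : row_full <<u>>%MS.
  apply: irr => [s sS | ].
    rewrite genmxE (eqmxMr _ (genmxE u)); have [c [d ->]] := rel_atP hS sS.
    exact: (line_stab _ (deg_in gr c d)).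
  by rewrite -mxrank_eq0 genmxE mxrank_eq0.
by rewrite /row_full genmxE rank_rV u0 => /eqP.
Qed.

(** The restrictions of E to [W] commute, hence have a common eigenvector. *)
Lemma weight_exists (W : 'M[C]_n) : abelian E -> W != 0 ->
  {in E, forall a, stablemx W (A (f a))} ->
  exists lam v, weight_vec lam v /\ (v <= W)%MS.
Proof.
move=> /centsP cEE W0 stW.
have [||v v0 /allP stv] := @common_eigenvector C _ [seq restrictmx W (A (f a)) | a in E].
- by rewrite lt0n mxrank_eq0.
- move=> _ _ /imageP[a aE ->] /imageP[b bE ->]; rewrite /comm_mx.
  by rewrite -!conjmxM ?inE ?stablemx_row_base ?stW // -!module_fM // cEE.
have u0 : v *m row_base W != 0 by rewrite mulmx_free_eq0 ?row_base_free.
have [lam lamP] : exists lam : gT -> C, forall a, a \in E ->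
    v *m row_base W *m A (f a) = lam a *: (v *m row_base W).
  apply: (@fin_all_exists gT (fun=> C) (fun a c => a \in E ->
    v *m row_base W *m A (f a) = c *: (v *m row_base W))) => a; case aE : (a \in E); last by exists 0.
  have /sub_rVP[c e] : stablemx (v *m row_base W) (A (f a)).
    by rewrite -stablemx_restrict ?stW // stv ?image_f.
  by exists c.
by exists lam, (v *m row_base W); rewrite mulmx_sub ?eq_row_base.
Qed.

(** * The submodule generated by a vector of nontrivial weight *)

Section Orbit.

Variables (lam : gT -> C) (v : 'rV[C]_n) (x0 : X) (pt : quo T -> X).
Hypothesis hv : weight_vec lam v.
Hypothesis nontriv : ~ {in E, forall a, lam a = 1}.
Hypothesis ptK : forall j, coset_cls T (pt j) = j.

Let w j := v *m A (rel_at x0 (pt j)).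
(** One vector per coset, that is, one per degree from [x0]. *)
Definition orbit_mx : 'M[C]_n := (\sum_(j : quo T | w j != 0) <<w j>>)%MS.

Lemma deg_pt x y : deg x (pt (coset_cls T y)) = deg x y.
Proof.
have := ptK (coset_cls T y); move/eqP; rewrite (coset_cls_eq hS fact).
by rewrite -(deg_eq1 gr) => /eqP e; rewrite -[RHS](degM gr x (pt (coset_cls T y))) e mulg1.
Qed.

Lemma deg_pt_inj j k : deg x0 (pt j) = deg x0 (pt k) -> j = k.
Proof.
move=> e; rewrite -(ptK j) -(ptK k); apply/eqP; rewrite (coset_cls_eq hS fact) -(deg_eq1 gr).
by rewrite -(degM gr (pt j) x0) (deg_inv fact gr x0) e mulVg.
Qed.

Lemma orbit_mx_sub y : (v *m A (rel_at x0 y) <= orbit_mx)%MS.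
Proof.
have le := weight_same_deg hv (deg_pt x0 y); apply: submx_trans le _.
have [-> | nz] := eqVneq (v *m A (rel_at x0 (pt (coset_cls T y)))) 0; first exact: sub0mx.
by rewrite (sumsmx_sup (coset_cls T y)) ?genmxE.
Qed.

Lemma orbit_mx_stable s : s \in S -> stablemx orbit_mx (A s).
Proof.
move=> sS; rewrite /orbit_mx sumsmxMr_gen; apply/sumsmx_subP => j _.
have [a [b ->]] := rel_atP hS sS; have [y <-] := rel_out hS a b (pt j).
rewrite genmxE (submx_trans (submxMr _ (_ : _ <= w j)%MS)) ?genmxE //.
exact: submx_trans (weight_path hv x0 (pt j) y) (orbit_mx_sub y).
Qed.

Lemma orbit_mx_v : (v <= orbit_mx)%MS.
Proof.
have := orbit_mx_sub x0; rewrite (eqP (_ : rel_at x0 x0 == rel_id X)) ?(rel_at_id hS) //.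
by rewrite (module1 hA) mulmx1.
Qed.

(** For a character [mu], this is [#|E|] times the projection onto the [mu]-isotypic part. *)
Definition weight_proj (mu : gT -> C) : 'M[C]_n := \sum_(a in E) (mu a)^-1 *: A (f a).

Lemma weight_proj_id mu u : weight_vec mu u -> u *m weight_proj mu = #|E|%:R *: u.
Proof.
move=> hu; rewrite mulmx_sumr -sum1_card natr_sum scaler_suml; apply: eq_bigr => a aE.
by rewrite -scalemxAr (hu.2 _ aE) scalerA mulVf ?(weight_neq0 hu).
Qed.

(** Orthogonality of characters: shifting the summation index by an element where [mu] and [nu]
    differ multiplies the sum by a scalar other than 1. *)
Lemma weight_proj_0 mu nu u u' : weight_vec mu u -> weight_vec nu u' ->
  ~ {in E, mu =1 nu} -> u *m weight_proj nu = 0.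
Proof.
move=> hu hu' neq.
have [b bE bneq] : exists2 b, b \in E & mu b != nu b.
  by apply/exists_inP; apply: contra_notT neq => /exists_inPn h b /h; rewrite negbK => /eqP.
have -> : u *m weight_proj nu = (\sum_(a in E) (nu a)^-1 * mu a) *: u.
  rewrite mulmx_sumr scaler_suml; apply: eq_bigr => a aE.
  by rewrite -scalemxAr (hu.2 _ aE) scalerA.
set s := \sum_(a in E) _; suff -> : s = 0 by rewrite scale0r.
have: (nu b)^-1 * mu b * s = s.
  rewrite [s in RHS](reindex_inj (mulgI b)) /s mulr_sumr /=.
  apply: eq_big => [a | a aE]; first by rewrite groupMl.
  by rewrite (weightM hu) // (weightM hu') // invfM mulrACA.
move/eqP; rewrite -subr_eq0 -{2}[s]mul1r -mulrBl mulf_eq0 => /orP[|/eqP //].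
rewrite subr_eq0 => /eqP/(congr1 ( *%R (nu b))); rewrite mulrA mulfV ?(weight_neq0 hu') //.
by rewrite mul1r mulr1 => e; rewrite e eqxx in bneq.
Qed.

Let proj j := weight_proj (twist lam x0 (pt j)).

Lemma orbit_proj j k : w j != 0 -> w k != 0 ->
  w j *m proj k = if j == k then #|E|%:R *: w j else 0.
Proof.
move=> wj wk; have hj := weight_twist hv wj; have hk := weight_twist hv wk.
case: eqP => [<- | neq]; first exact: weight_proj_id.
apply: weight_proj_0 hj hk _ => e; apply: neq; apply: deg_pt_inj.
exact: twist_inj hv nontriv wj wk e.
Qed.

Lemma card_natr_neq0 : #|E|%:R != 0 :> C.
Proof. by rewrite pnatr_eq0 -lt0n cardG_gt0. Qed.

(** The characters of the [w j] are pairwise distinct, so [proj j] kills all other summands while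
    scaling [w j] by [#|E|]. *)
Lemma orbit_mx_direct : mxdirect (\sum_(j : quo T | w j != 0) <<w j>>).
Proof.
apply/mxdirect_sumsP => j wj; apply/eqP; rewrite -submx0; apply/rV_subP => u.
rewrite sub_capmx genmxE => /andP[/sub_rVP[c uE] uS].
have uj : u *m proj j = #|E|%:R *: u.
  by rewrite uE -scalemxAl orbit_proj // eqxx !scalerA mulrC.
have : (u *m proj j <= (0 : 'M[C]_n))%MS.
  apply: submx_trans (submxMr _ uS) _; rewrite sumsmxMr_gen.
  apply/sumsmx_subP => k /andP[wk kj]; rewrite genmxE.
  rewrite (submx_trans (submxMr _ (_ : _ <= w k)%MS)) ?genmxE //.
  by rewrite orbit_proj // (negPf kj) sub0mx.
by rewrite uj eqmx_scale ?card_natr_neq0.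
Qed.

Lemma orbit_mx_rank : \rank orbit_mx = #|[set j | w j != 0]|.
Proof.
rewrite (mxdirectP orbit_mx_direct) /= -sum1_card.
rewrite (eq_bigl (fun j => w j != 0)) => [|j]; last by rewrite inE.
by apply: eq_bigr => j wj; rewrite mxrank_gen rank_rV wj.
Qed.

(** Projecting a nonzero vector of [W] puts some nonzero [w j] into [W]; [weight_back] then returns
    to [v], which generates the rest. *)
Lemma orbit_mx_simple (W : 'M[C]_n) : {in S, forall s, stablemx W (A s)} ->
  W != 0 -> (W <= orbit_mx)%MS -> (orbit_mx <= W)%MS.
Proof.
move=> stW /rowV0Pn[u uW u0] WU.
have stabP z s : (z <= W)%MS -> s \in S -> (z *m A s <= W)%MS.
  by move=> zW sS; apply: submx_trans (submxMr _ zW) (stW s sS).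
have /sub_sumsmxP[b uE] := submx_trans uW WU.
have projW k : (u *m proj k <= W)%MS.
  rewrite /proj /weight_proj mulmx_sumr summx_sub // => a aE.
  by rewrite -scalemxAr scalemx_sub // stabP // (thin_in fact).
have [j wj jW] : exists2 j, w j != 0 & (w j <= W)%MS.
  have [j wj bj] : exists2 j, w j != 0 & b j *m <<w j>>%MS != 0.
    apply/exists_inP; apply: contraNT u0 => /exists_inPn h.
    by rewrite uE big1 // => j /h; rewrite negbK => /eqP.
  exists j => //; have /sub_rVP[c bE] : (b j *m <<w j>> <= w j)%MS.
    by rewrite (submx_trans (submxMl _ _)) ?genmxE.
  have c0 : c != 0 by apply: contraNneq bj => c0; rewrite bE c0 scale0r.
  have := projW j; rewrite uE mulmx_suml (bigD1 j) //= bE -scalemxAl orbit_proj // eqxx.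
  rewrite big1 ?addr0 => [|k /andP[wk kj]].
    by rewrite !eqmx_scale ?card_natr_neq0.
  have /sub_rVP[d ->] : (b k *m <<w k>> <= w k)%MS.
    by rewrite (submx_trans (submxMl _ _)) ?genmxE.
  by rewrite -scalemxAl orbit_proj // (negPf kj) scaler0.
have vW : (v <= W)%MS.
  have [c c0 vc] := weight_back hv (weight_stab hv x0 (pt j) wj).
  by have := stabP _ _ (rel_at (pt j) x0) jW (rel_at_in hS _ _); rewrite vc eqmx_scale.
apply/sumsmx_subP => k _; rewrite genmxE; apply: stabP => //; exact: rel_at_in.
Qed.

Definition weight_ker := [set a in E | lam a == 1].

Lemma group_set_weight_ker : group_set weight_ker.
Proof.
apply/group_setP; split=> [|a b]; first by rewrite inE group1 (weight1 hv) eqxx.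
rewrite !inE => /andP[aE /eqP la] /andP[bE /eqP lb].
by rewrite groupM // (weightM hv) // la lb mulr1 eqxx.
Qed.
Canonical weight_ker_group := Group group_set_weight_ker.

Lemma weight_ker_proper : weight_ker \proper E.
Proof.
rewrite properE; apply/andP; split; first by apply/subsetP => a; rewrite inE => /andP[].
apply/negP => /subsetP sub; apply: nontriv => a /sub.
by rewrite inE => /andP[_ /eqP].
Qed.

Variable p : nat.
Hypotheses (pr_p : prime p) (cardE : #|E| = (p ^ 2)%N) (abelE : abelian E).

Lemma orbit_support j : (w j != 0) = (lstabE x0 (pt j) \subset weight_ker).
Proof.
apply/(weight_stab hv x0 (pt j))/subsetP => sub a aL; last first.
  by have := sub a aL; rewrite inE => /andP[_ /eqP].
by rewrite inE (subsetP (lstabE_sub _ _ _ _ _) _ aL) sub ?eqxx.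
Qed.

Lemma eq_coset_cls j : (j == coset_cls T x0) = (deg x0 (pt j) == 1%g).
Proof. by rewrite (deg_eq1 gr) -(coset_cls_eq hS fact) ptK eq_sym. Qed.

Lemma E_gt1 : (1 < #|E|)%N.
Proof. by rewrite cardE (ltn_exp2l 0) ?prime_gt1. Qed.

(** With a trivial kernel only degree 1 would contribute to the rank, every other stabiliser being
    nontrivial. *)
Lemma weight_ker_neq1 : \rank orbit_mx != 1%N -> weight_ker != 1%g.
Proof.
rewrite orbit_mx_rank; apply: contraNneq => K1; apply/cards1P.
exists (coset_cls T x0); apply/setP => j; rewrite !inE orbit_support K1 eq_coset_cls.
apply/idP/eqP => [L1 | /(lstabE_trivial hS fact gr) -> //].
apply: contraTeq L1 => /(lstabE_neq1 hS fact gr hmin prG abelE E_gt1).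
apply: contraNN => L1; apply/eqP.
exact: (elimT (trivgP (G := lstabE_group hS fact x0 (pt j))) L1).
Qed.

(** Degree 1 always contributes. Elsewhere the stabiliser is nontrivial and the kernel proper in a
    group of order p^2, so inclusion is equality. *)
Lemma orbit_mx_line :
  \rank orbit_mx = #|line S (f @: weight_ker) (coset_cls T x0)|.
Proof.
rewrite orbit_mx_rank; apply: eq_card => j; rewrite !inE orbit_support eq_coset_cls.
have -> : lstab_pts S (coset_cls T x0) j = f @: lstabE x0 (pt j).
  by rewrite -{1}(ptK j) (lstab_ptsE hS fact).
have [d1 | d1] := eqVneq (deg x0 (pt j)) 1%g.
  by rewrite (lstabE_trivial hS fact gr d1) sub1G.
apply/idP/eqP => [sub | e].
  suff -> : lstabE x0 (pt j) = weight_ker by [].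
  apply: (psquare_subgroup_eq (H := lstabE_group hS fact x0 (pt j)) pr_p cardE
            (K := weight_ker_group) sub weight_ker_proper).
  by apply: (lstabE_neq1 hS fact gr hmin prG abelE) => //; exact: E_gt1.
apply/subsetP => a aL; have : f a \in f @: weight_ker by rewrite -e imset_f.
case/imsetP=> b bK /(thin_inj fact) -> //; first exact: subsetP (lstabE_sub _ _ _ _ _) _ aL.
by move: bK; rewrite inE => /andP[].
Qed.

End Orbit.

End Modules.

(** * Representations of the adjacency algebra *)

Section Adjacency.

Variables (X : finType) (S : {set {set X * X}}).
Hypothesis hS : association_scheme S.
Variable C : numClosedFieldType.
Local Notation rel_at := (rel_at S).
Local Notation adj := (@adj_mx C X).
Local Notation sigma := (sigma C S).

Lemma adj_mx_module : scheme_module S adj.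
Proof.
split=> [|s u sS uS]; apply/matrixP => i j; rewrite !mxE.
  by rewrite inE /= (inj_eq enum_val_inj).
set x := enum_val i; set y := enum_val j.
rewrite summxE (bigD1 (rel_at x y)) ?rel_at_in //= !mxE.
rewrite (mem_rel_at hS) ?rel_at_in // eqxx mulr1 [X in _ + X]big1 ?addr0 => [|w /andP[wS wn]]; last first.
  by rewrite !mxE (mem_rel_at hS) // eq_sym (negPf wn) mulr0.
rewrite int_numE //; set Z := [set z | _].
rewrite -[#|Z|]sum1_card natr_sum (reindex_onto enum_rank enum_val) /=; last first.
  by move=> z _; rewrite enum_valK.
rewrite [RHS]big_mkcond /=; apply: eq_big => [z | z _]; first by rewrite enum_rankK eqxx.
rewrite !mxE !(mem_rel_at hS) // enum_rankK /Z inE.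
by do 2!case: (_ == _); rewrite ?mulr0 ?mul0r ?mulr1.
Qed.

Lemma adj_mx_in s : s \in S -> adj s \in adj_space C S.
Proof. by move=> sS; apply/memv_span/image_f. Qed.

Lemma vsval_sigma s : s \in S -> vsval (sigma s) = adj s.
Proof. by move=> sS; rewrite vsprojK ?adj_mx_in. Qed.

Lemma adj_space_ind (P : 'M[C]_#|X| -> Prop) :
  P 0 -> (forall u v, P u -> P v -> P (u + v)) -> (forall c u, P u -> P (c *: u)) ->
  {in S, forall s, P (adj s)} -> forall a : adj_alg C S, P (vsval a).
Proof.
move=> P0 PD PZ PS a; have := coord_span (X := in_tuple [seq adj s | s in S]) (subvsP a).
move=> ->; apply: (big_ind P) => // i _; apply: PZ.
have /imageP[s sS ->] : [seq adj s | s in S]`_i \in [seq adj s | s in S] by rewrite mem_nth.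
exact: PS.
Qed.

Lemma vsval_adj_mul (a b : adj_alg C S) : vsval (adj_mul a b) = vsval a *m vsval b.
Proof.
rewrite vsprojK //; apply: (adj_space_ind (P := fun m => m *m vsval b \in adj_space C S)).
- by rewrite mul0mx mem0v.
- by move=> u v hu hv; rewrite mulmxDl memvD.
- by move=> c u hu; rewrite -scalemxAl memvZ.
move=> s sS; apply: (adj_space_ind (P := fun m => adj s *m m \in adj_space C S)).
- by rewrite mulmx0 mem0v.
- by move=> u v hu hv; rewrite mulmxDr memvD.
- by move=> c u hu; rewrite -scalemxAr memvZ.
move=> u uS; rewrite (moduleM adj_mx_module) // memv_suml // => w wS.
by rewrite memvZ ?adj_mx_in.
Qed.

Lemma adj_repr_module d (rho : {linear adj_alg C S -> 'M[C]_d}) :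
  adj_repr rho -> scheme_module S (rho \o sigma).
Proof.
case=> rho1 rhoM; split=> [|s u sS uS] //=; rewrite -rhoM.
suff -> : adj_mul (sigma s) (sigma u) = \sum_(w in S) (int_num s u w)%:R *: sigma w.
  by rewrite linear_sum; apply: eq_bigr => w _; rewrite linearZ.
apply: val_inj; rewrite [LHS]vsval_adj_mul !vsval_sigma // (moduleM adj_mx_module) //.
rewrite linear_sum; apply: eq_bigr => w wS.
by rewrite linearZ /= vsval_sigma.
Qed.

Lemma adj_irr_module d (rho : {linear adj_alg C S -> 'M[C]_d}) : adj_irr rho ->
  forall U : 'M[C]_d, {in S, forall s, stablemx U (rho (sigma s))} -> U != 0 -> row_full U.
Proof.
case=> _ irr U stU; apply: irr => a; rewrite -(vsvalK a).
apply: (adj_space_ind (P := fun m => stablemx U (rho (vsproj _ m)))).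
- by rewrite linear0 linear0 mulmx0 sub0mx.
- by move=> u v hu hv; rewrite linearD linearD mulmxDr addmx_sub.
- by move=> c u hu; rewrite linearZ linearZ -scalemxAr scalemx_sub.
by move=> s sS; apply: stU.
Qed.

(** The action on [U] is written in the basis [row_base U]; an invariant subspace of coordinates
    lifts to a submodule inside [U], and ranks are compared. *)
Lemma submodule_repr (U : 'M[C]_#|X|) :
  {in S, forall s, stablemx U (adj s)} -> U != 0 ->
  (forall W : 'M[C]_#|X|, {in S, forall s, stablemx W (adj s)} ->
     W != 0 -> (W <= U)%MS -> (U <= W)%MS) ->
  exists rho : {linear adj_alg C S -> 'M[C]_(\rank U)}, adj_repr rho /\ adj_irr rho.
Proof.
move=> stU U0 simpU.
have stUa a : stablemx U (vsval (a : adj_alg C S)).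
  apply: (adj_space_ind (P := fun m => stablemx U m)) => [|u v hu hv|c u hu|s sS]; last exact: stU.
  - by rewrite mulmx0 sub0mx.
  - by rewrite mulmxDr addmx_sub.
  - by rewrite -scalemxAr scalemx_sub.
pose r (a : adj_alg C S) := restrictmx U (vsval a).
have linr : linear r.
  by move=> c a b; rewrite /r /conjmx [vsval _]linearP /= mulmxDr mulmxDl -scalemxAr -scalemxAl.
pose rho : {linear adj_alg C S -> 'M[C]_(\rank U)} :=
  HB.pack r (GRing.isLinear.Build _ _ _ _ r linr).
exists rho; split.
  split=> [|a b]; rewrite /= /r.
    rewrite vsval_sigma ?(module1 adj_mx_module); last by case: hS.
    by rewrite conjmx_scalar ?row_base_free.
  by rewrite vsval_adj_mul conjmxM // inE stablemx_row_base.
split=> [|W stW W0]; first by rewrite lt0n mxrank_eq0.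
have sub : (U <= <<W *m row_base U>>)%MS.
  apply: simpU => [s sS| |].
  - rewrite genmxE (eqmxMr _ (genmxE _)) -stablemx_restrict ?stU //.
    by have := stW (sigma s); rewrite /= /r vsval_sigma.
  - by rewrite -mxrank_eq0 genmxE mxrankMfree ?row_base_free // mxrank_eq0.
  - by rewrite genmxE (submx_trans (submxMl _ _)) ?eq_row_base.
rewrite /row_full eqn_leq rank_leq_col /=.
by have := mxrankS sub; rewrite genmxE mxrankMfree ?row_base_free.
Qed.

End Adjacency.

(** * Degrees and lines *)

Section Lines.

Variables (X : finType) (S : {set {set X * X}}).
Hypothesis hS : association_scheme S.
Variables (T : {set {set X * X}}) (gT : finGroupType) (E : {group gT}).
Variables (f : gT -> {set X * X}) (act : X -> gT -> X).
Hypothesis fact : thin_action S T E f act.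
Variable C : numClosedFieldType.
Local Notation adj := (@adj_mx C X).

(* On the image of e_K (t - 1), where e_K is the sum of K and t lies outside K,
   K acts trivially and the sum of E acts as 0, so E does not act trivially. *)
Lemma nontrivial_weight (K : {group gT}) : abelian E -> K \proper E ->
  exists lam v, [/\ weight_vec E f adj lam v, {in K, forall a, lam a = 1}
                  & ~ {in E, forall a, lam a = 1}].
Proof.
move=> abelE /properP[sKE [t tE tK]]; have /centsP cEE := abelE.
have hA := adj_mx_module hS C; have fM := module_fM hS fact hA.
pose eK := \sum_(a in K) adj (f a); pose W := eK *m (adj (f t) - 1%:M).
have comA a : a \in E -> comm_mx (adj (f a)) W.
  move=> aE; rewrite /W; apply: comm_mxM; last first.
    by apply: comm_mxB (comm_mx1 _); rewrite /comm_mx -!fM ?(cEE a aE t).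
  rewrite /comm_mx mulmx_sumr mulmx_suml; apply: eq_bigr => b /(subsetP sKE) bE.
  by rewrite -!fM // (cEE a aE b).
have [x _] : exists x : X, True by case: hS => /card_gt0P[x _]; exists x.
(* A diagonal entry of [W] is -1: no product of [t] with an element of K is the identity, and in
   [eK] only the identity meets the diagonal. *)
have W0 : W != 0.
  have diag a : a \in E -> adj (f a) (enum_rank x) (enum_rank x) = (a == 1%g)%:R.
    move=> aE; rewrite mxE !enum_rankK (mem_thin hS fact) //; congr (nat_of_bool _)%:R.
    apply/eqP/eqP => [e | ->]; last by rewrite (thin_act1 fact).
    by apply: (act_free fact (x := x)); rewrite ?(thin_act1 fact).
  apply/eqP => /matrixP/(_ (enum_rank x) (enum_rank x)).
  rewrite /W /eK mulmxBr mulmx1 mulmx_suml !mxE !summxE.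
  rewrite big1 ?add0r => [|a aK]; last first.
    have aE := subsetP sKE a aK; rewrite -fM // diag ?groupM //.
    case: eqP => // at1; case/negP: tK.
    by rewrite (_ : t = a^-1%g) ?groupV //; apply/esym/eqP; rewrite eq_invg_mul at1.
  rewrite (bigD1 1%g) //= diag // eqxx big1 ?addr0 => [|a /andP[aK a1]].
    by move/eqP; rewrite oppr_eq0 oner_eq0.
  by rewrite diag ?(subsetP sKE) // (negPf a1).
have stW : {in E, forall a, stablemx W (adj (f a))}.
  by move=> a aE; rewrite -(comA a aE) submxMl.
have [lam [v [hv vW]]] := weight_exists hS fact hA abelE W0 stW.
have fixK a : a \in K -> W *m adj (f a) = W.
  move=> aK; have aE := subsetP sKE a aK; rewrite -(comA a aE) /W mulmxA; congr (_ *m _).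
  rewrite mulmx_sumr /eK [RHS](reindex_inj (mulgI a)) /=.
  apply: eq_big => [b | b bK]; first by rewrite groupMl.
  by rewrite fM // (subsetP sKE).
have killE : W *m (\sum_(a in E) adj (f a)) = 0.
  rewrite -mulmxA mulmxBl mul1mx (_ : adj (f t) *m _ = \sum_(a in E) adj (f a)).
    by rewrite subrr mulmx0.
  rewrite mulmx_sumr [RHS](reindex_inj (mulgI t)) /=.
  apply: eq_big => [b | b bE]; first by rewrite groupMl.
  by rewrite fM.
have /submxP[z vE] := vW; exists lam, v; split=> // [a aK | triv].
  have /eqP := hv.2 _ (subsetP sKE a aK); rewrite vE -mulmxA fixK // -vE.
  rewrite -{1}[v]scale1r eq_sym -subr_eq0 -scalerBl scaler_eq0 (negPf hv.1) orbF.
  by rewrite subr_eq0 => /eqP.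
(* A trivial [lam] would make the sum of E act on [v] by a nonzero scalar, although it kills [W]. *)
have : v *m (\sum_(a in E) adj (f a)) = #|E|%:R *: v.
  rewrite mulmx_sumr -sum1_card natr_sum scaler_suml; apply: eq_bigr => a aE.
  by rewrite (hv.2 _ aE) triv.
rewrite {1}vE -mulmxA killE mulmx0 => /esym/eqP.
by rewrite scaler_eq0 (negPf hv.1) orbF (negPf (card_natr_neq0 E C)).
Qed.

Lemma rel_subgroup_im (K : {group gT}) : K \subset E -> rel_subgroup (f @: K) T.
Proof.
move=> /subsetP sKE; apply/and4P; split.
- by apply/subsetP => _ /imsetP[a aK ->]; apply: (thin_in_T fact); apply: sKE.
- by rewrite -(thin_f1 hS fact) imset_f.
- apply/forall_inP => _ /imsetP[a aK ->].
  by rewrite -(thin_fV hS fact) ?sKE // imset_f ?groupV.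
apply/forall_inP => _ /imsetP[a aK ->]; apply/forall_inP => _ /imsetP[b bK ->].
by rewrite -(thin_fM hS fact) ?sKE // imset_f ?groupM.
Qed.

Lemma rel_subgroup_preim M : rel_subgroup M T ->
  exists2 K : {group gT}, K \subset E & M = f @: K.
Proof.
case/and4P=> MT M1 /forall_inP MV /forall_inP MM.
have gK : group_set [set a in E | f a \in M].
  apply/group_setP; split=> [|a b]; first by rewrite inE group1 (thin_f1 hS fact).
  rewrite !inE => /andP[aE aM] /andP[bE bM]; rewrite groupM //= (thin_fM hS fact) //.
  exact: forall_inP (MM _ aM) _ bM.
exists (Group gK); first by apply/subsetP => a; rewrite inE => /andP[].
apply/setP => s; apply/idP/imsetP => [sM | [a]]; last by rewrite inE => /andP[_ aM] ->.
have := subsetP MT s sM; rewrite -(thin_im fact) => /imsetP[a aE e].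
by exists a; rewrite // inE aE -e.
Qed.

Lemma thin_proper_im (H K : {set gT}) : K \subset E -> H \subset K ->
  (f @: H \proper f @: K) = (H \proper K).
Proof.
move=> sKE sHK; rewrite !properEcard sHK imsetS //= !card_in_imset //.
  by move=> a b aK bK; apply: (thin_inj fact); apply: subsetP sKE _ _.
by move=> a b aH bH; apply: (thin_inj fact); apply: subsetP (subset_trans sHK sKE) _ _.
Qed.

Lemma thin_im_triv : f @: (1%g : {set gT}) = [set rel_id X].
Proof. by rewrite imset_set1 (thin_f1 hS fact). Qed.

Variables (hT : finGroupType) (G : {group hT}) (deg : X -> X -> hT).
Hypothesis gr : grading S T G deg.
Hypothesis hmin : forall K, strongly_normal S K -> T \subset K.
Hypothesis prG : prime #|G|.
Variable p : nat.
Hypotheses (pr_p : prime p) (cardE : #|E| = (p ^ 2)%N) (abelE : abelian E).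

Lemma coset_reprs : exists pt : quo T -> X, forall j, coset_cls T (pt j) = j.
Proof.
apply: (@fin_all_exists _ (fun=> X) (fun j x => coset_cls T x = j)) => j.
by have [x ->] := coset_clsP j; exists x.
Qed.

(** The orbit of a weight vector is a nonzero submodule, hence the whole module; its weight is
    nontrivial because the degree is not 1. *)
Lemma irr_degree_line (chi : adj_alg C S -> C) : Irr chi ->
  chi (sigma C S (rel_id X)) != 1 ->
  exists2 l, l \in lines S T & chi (sigma C S (rel_id X)) = #|l|%:R.
Proof.
case=> n [rho [rep irr chiE]]; rewrite chiE rep.1 mxtrace1 pnatr_eq1 => n1.
have hA := adj_repr_module hS rep; have irrA := adj_irr_module irr.
have [||lam [v [hv _]]] := @weight_exists _ _ hS _ _ _ _ _ fact _ _ _ hA 1%:M abelE.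
- by rewrite -mxrank_eq0 mxrank1 -lt0n; case: irr.
- by move=> a _; exact: submx1.
have nontriv : ~ {in E, forall a, lam a = 1}.
  move=> triv; case/negP: (n1); apply/eqP.
  exact: (weight_triv_dim hS fact gr hA prG hv triv irrA).
have [pt ptK] := coset_reprs.
have [x0 _] : exists x : X, True by case: hS => /card_gt0P[x _]; exists x.
set U := orbit_mx S (rho \o sigma C S) v x0 pt.
have rankU : \rank U = n.
  apply/eqP/irrA => [s sS|].
    exact: (orbit_mx_stable hS fact gr hA _ hv ptK).
  have : (v <= U)%MS := orbit_mx_v hS fact gr hA _ hv ptK.
  by apply: contraTneq => ->; rewrite submx0 hv.1.
pose K := weight_ker_group hS fact hA hv.
have KE : K \proper E := weight_ker_proper nontriv.
have rankL : \rank U = #|line S (f @: K) (coset_cls T x0)|.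
  exact: (orbit_mx_line hS fact gr hA hmin prG _ hv nontriv ptK pr_p cardE abelE).
exists (line S (f @: K) (coset_cls T x0)); last by rewrite -rankL rankU.
rewrite inE; apply/existsP; exists (f @: K); apply/existsP; exists (coset_cls T x0).
have sKE := proper_sub KE; apply/and5P; split=> //.
- exact: rel_subgroup_im sKE.
- rewrite -thin_im_triv thin_proper_im ?sub1G // properEneq sub1G andbT eq_sym.
  rewrite (weight_ker_neq1 hS fact gr hA hmin prG (x0 := x0) hv nontriv ptK pr_p) //.
  by rewrite -/U rankU.
- by rewrite -(thin_im fact) thin_proper_im.
by rewrite -rankL rankU.
Qed.

Lemma line_irr_degree l : l \in lines S T ->
  exists chi : adj_alg C S -> C,
    [/\ Irr chi, chi (sigma C S (rel_id X)) = #|l|%:R & #|l|%:R != 1 :> C].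
Proof.
rewrite inE => /existsP[M /existsP[i /and5P[MT M1 MT' l1 /eqP lE]]].
have [K sKE ME] := rel_subgroup_preim MT; rewrite {}ME in M1 MT' l1 lE.
have KE : K \proper E by rewrite -(thin_proper_im (subxx E) sKE) (thin_im fact).
have K1 : K :!=: 1%g.
  by move: M1; rewrite -thin_im_triv thin_proper_im ?sub1G // properEneq eq_sym => /andP[].
have [lam [v [hv lamK nontriv]]] := nontrivial_weight abelE KE.
have hA := adj_mx_module hS C; have [pt ptK] := coset_reprs.
(* The kernel contains the nontrivial K and is proper in a group of order p^2. *)
have kerK : weight_ker E lam = K.
  apply/esym; apply: (psquare_subgroup_eq (K := weight_ker_group hS fact hA hv) pr_p cardE) => //.
    by apply/subsetP => a aK; rewrite inE (subsetP sKE) // lamK ?eqxx.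
  exact: weight_ker_proper.
(* The base point is taken in the coset [i], so that the rank counts this very line. *)
have [x0 x0E] := coset_clsP i.
set U := orbit_mx S adj v x0 pt.
have rankU : \rank U = #|l|.
  rewrite lE x0E -kerK.
  exact: (orbit_mx_line hS fact gr hA hmin prG _ hv nontriv ptK pr_p cardE abelE).
have [||W stW W0 WU|rho [rep irr]] := @submodule_repr _ _ hS C U.
- by move=> s sS; exact: (orbit_mx_stable hS fact gr hA _ hv ptK).
- by rewrite -mxrank_eq0 rankU -lt0n lE; apply/card_gt0P; exists i; apply: setU11.
- exact: (orbit_mx_simple hS fact gr hA hmin prG hv nontriv ptK stW W0 WU).
exists (fun a => \tr (rho a)); split.
- by exists (\rank U), rho.
- by rewrite rep.1 mxtrace1 rankU.
by rewrite pnatr_eq1 lE.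
Qed.

End Lines.

Theorem theorem3p5 (R : realType) (p q : nat) (hp : prime p) (hq : prime q)
    (X : finType) (S : {set {set X * X}}) (hS : association_scheme S)
    (hi : exists (gT : finGroupType) (E : {group gT}),
        [/\ (p.-abelem E)%g, #|E| = (p ^ 2)%N & thin_isog S (thin_residue S) E])
    (hii : exists (gT : finGroupType) (G : {group gT}),
        [/\ cyclic G, #|G| = q
          & thin_isog (quo_rels S (thin_residue S))
                      (quo_rels S (thin_residue S)) G]) :
  forall d : R[i],
    (exists chi : adj_alg R[i] S -> R[i],
        [/\ Irr chi, chi (sigma R[i] S (rel_id X)) = d & d != 1]) <->
    (exists2 l : {set quo (thin_residue S)},
        l \in lines S (thin_residue S) & d = #|l|%:R).
Proof.
case: hi => gT [E [abelemE cardE /(thin_isog_action hS)[f [act fact]]]].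
case: hii => hT [G [_ cardG /(quotient_grading hS fact)[deg gr]]].
have hmin K : strongly_normal S K -> thin_residue S \subset K.
  by move=> hK; apply: bigcap_inf.
have abelE := abelem_abelian abelemE; have prG : prime #|G| by rewrite cardG.
move=> d; split=> [[chi [irr <- chi1]] | [l ll ->]].
  exact: (irr_degree_line hS fact gr hmin prG hp cardE abelE irr chi1).
exact: (line_irr_degree hS fact R[i] gr hmin prG hp cardE abelE ll).
Qed.
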